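(* Let $\mathbf{x}^*\in X$ be an optimal solution of $\min_{\mathbf{x}\in X}\Phi(\mathbf{x})$, let $\epsilon>0$ be a small tolerance, and let $\mathbf{x}^0\in X$ satisfy $\|\mathbf{x}^0-\mathbf{x}^*\|\le D_{\mathbf{x}}$ and $\Phi(\mathbf{x}^0)-\Phi(\mathbf{x}^* )\le D_\Phi$, where $D_{\mathbf{x}},D_\Phi>0$. Run the SCVRG algorithm (described in the context) from $\mathbf{x}^0$ with first epoch length $k_0=10$, number of epochs and step-size parameter $$S=\left\lfloor \log_2\left(\frac{6D_\Phi+15\ell D_{\mathbf{x}}^2}{\epsilon}\right)\right\rfloor+1,\qquad \eta=\frac{D_{\mathbf{x}}^2}{10D_\Phi+25\ell D_{\mathbf{x}}^2},$$ and sample sizes $a,b>0$ satisfying $$a\ge \frac{1620\,\ell^2D_{\mathbf{x}}^4}{\epsilon^2},\qquad b\ge\frac{810\,\ell^2D_{\mathbf{x}}^4}{\epsilon^2}.$$ Then the output $\widehat{\mathbf{x}}=\tilde{\mathbf{x}}^S\in X$ satisfies $\mathbb{E}[\Phi(\widehat{\mathbf{x}})]\le\Phi(\mathbf{x}^* )+\epsilon$, and (with $a,b$ taken to be the smallest integers satisfying these bounds) the number of samples required to return such $\widehat{\mathbf{x}}$ is upper bounded by $$O\left((m+n)\log(1/\epsilon)+1/\epsilon^3\right),$$ where the constant hidden in $O(\cdot)$ may depend on $\ell,D_{\mathbf{x}},D_\Phi$ but not on $m,n,\epsilon$.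
   Context: **Problem.** $\min_{\mathbf{x}\in X}\Phi(\mathbf{x})=F(\mathbf{x})+r(\mathbf{x})$, where $F(\mathbf{x})=\frac1n\sum_{i=1}^n f_i\big(\frac1m\sum_{j=1}^m g_j(\mathbf{x})\big)$, $X\subseteq\mathbb{R}^d$ is a convex set, $f_i:\mathbb{R}^k\to\mathbb{R}$ and $g_j:X\to\mathbb{R}^k$ are continuously differentiable (possibly nonconvex), and $r$ is an extended real-valued closed convex function on $\mathbb{R}^d$. Write $f=\frac1n\sum_i f_i$, $g=\frac1m\sum_j g_j$; $\partial g$ denotes the Jacobian of $g$, and $\nabla F(\mathbf{x})=[\partial g(\mathbf{x})]^\top\nabla f(g(\mathbf{x}))$, where $\nabla f(g(\mathbf{x}))$ is the gradient of $f$ at the point $g(\mathbf{x})$. $\|\cdot\|$ is the $\ell_2$-norm for vectors and the spectral norm for matrices. A point $\mathbf{x}^*\in X$ is an optimal solution if $\Phi(\mathbf{x})\ge\Phi(\mathbf{x}^* )$ for all $\mathbf{x}\in X$. **Standing assumptions.** (1) $F$ and $r$ are convex on $X$, $X$ is bounded, and the proximal mapping $\mathrm{prox}_r^\eta(\mathbf{x})=\mathrm{argmin}_{\mathbf{y}\in X}\{r(\mathbf{y})+\frac{1}{2\eta}\|\mathbf{y}-\mathbf{x}\|^2\}$ can be computed for any $\mathbf{x}$ and $\eta>0$. (2) Each $f_i$ is $L_f$-Lipschitz and $\nabla f_i$ is $\ell_f$-Lipschitz on $\mathbb{R}^k$; each $g_j$ is $L_g$-Lipschitz and $\partial g_j$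 is $\ell_g$-Lipschitz on $X$. Set $\ell=L_f\ell_g+L_g^2\ell_f$. **SCVRG algorithm.** Inputs: $\mathbf{x}^0$, first epoch length $k_0$, $\eta>0$, number of epochs $S$, sample sizes $a,b$. Set $T=k_02^S-k_0$, $l=0$, $\tilde{\mathbf{x}}^0=\mathbf{x}^0$, and let the first epoch start at $\mathbf{x}_0^1=\mathbf{x}^0$. For $s=0,1,\dots,S-1$, with epoch length $K_s=k_02^s$: - If $s\ge1$, set $\mathbf{x}_0^{s+1}$ equal to the last iterate $\mathbf{x}^{s}_{K_{s-1}}$ of the previous epoch. Compute $\tilde{\mathbf{g}}^{s+1}=g(\tilde{\mathbf{x}}^s)$, $\tilde{\mathbf{z}}^{s+1}=\partial g(\tilde{\mathbf{x}}^s)$, $\tilde{\mathbf{v}}^{s+1}=[\tilde{\mathbf{z}}^{s+1}]^\top\nabla f(\tilde{\mathbf{g}}^{s+1})$. - For $t=0,\dots,K_s-1$: sample uniformly with replacement (independently of the past) a collection $\mathcal{A}_t$ of $a$ indices from $\{1,\dots,m\}$ and a collection $\mathcal{B}_t$ of $b$ indices from $\{1,\dots,n\}$, and set $$\mathbf{g}_t^{s+1}=\tilde{\mathbf{g}}^{s+1}+\tfrac1a\sum_{j\in\mathcal{A}_t}\big(g_j(\mathbf{x}_t^{s+1})-g_j(\tilde{\mathbf{x}}^s)\big),\quad \mathbf{z}_t^{s+1}=\tilde{\mathbf{z}}^{s+1}+\tfrac1a\sum_{j\in\mathcal{A}_t}\big(\partial g_j(\mathbf{x}_t^{s+1})-\partial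 g_j(\tilde{\mathbf{x}}^s)\big),$$ $$\mathbf{v}_t^{s+1}=\tilde{\mathbf{v}}^{s+1}+\tfrac1b\sum_{i\in\mathcal{B}_t}\big([\mathbf{z}_t^{s+1}]^\top\nabla f_i(\mathbf{g}_t^{s+1})-[\tilde{\mathbf{z}}^{s+1}]^\top\nabla f_i(\tilde{\mathbf{g}}^{s+1})\big).$$ Then increase $l$ by $1$, set $\eta_{t+1}^{s+1}=\eta\sqrt{T}/\sqrt{2T-l}$, and $\mathbf{x}_{t+1}^{s+1}=\mathrm{prox}_r^{\eta_{t+1}^{s+1}}\big(\mathbf{x}_t^{s+1}-\eta_{t+1}^{s+1}\mathbf{v}_t^{s+1}\big)$. - Set $\tilde{\mathbf{x}}^{s+1}=\frac{1}{K_s}\sum_{t=0}^{K_s-1}\mathbf{x}_t^{s+1}$. Output $\tilde{\mathbf{x}}^S$. **Number of samples.** The total number of evaluations of individual $g_j(\mathbf{x})$ or $\partial g_j(\mathbf{x})$ with $\mathbf{x}\in\mathbb{R}^d$, and of individual $f_i(\mathbf{y})$ or $\nabla f_i(\mathbf{y})$ with $\mathbf{y}\in\mathbb{R}^k$. *)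

(* Defs.v *)
(* Points of R^d are column vectors 'cV[R]_d, so that the Jacobian of a map
   R^d -> R^k is a k x d matrix. *)
From HB Require Import structures.
From mathcomp Require Import all_boot all_order all_algebra.
From mathcomp Require Import all_classical all_reals all_analysis.
Set Implicit Arguments.
Unset Strict Implicit.
Unset Printing Implicit Defensive.
Import Order.TTheory GRing.Theory Num.Theory.
Import numFieldNormedType.Exports.
Local Open Scope classical_set_scope.
Local Open Scope ring_scope.

(* The library norm on matrices is the sup norm: it is used below only for
   topological notions, where the choice of the norm is irrelevant. *)
Definition l2norm (R : realType) (p : nat) (u : 'cV[R]_p) : R :=
  Num.sqrt (\sum_i u i ord0 ^+ 2).

Definition specnorm (R : realType) (p q : nat) (A : 'M[R]_(p, q)) : R :=
  sup [set l2norm (A *m u) | u in [set u : 'cV[R]_q | l2norm u <= 1]].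

Definition grad (R : realType) (p : nat) (h : 'cV[R]_p -> R) (y : 'cV[R]_p) :
    'cV[R]_p :=
  \col_i 'D_(delta_mx i ord0) (h : 'cV[R]_p -> R^o) y.

(* J is a Jacobian at x of h, seen as a map on D only.  It is the usual Jacobian
   if x is interior to D, and it is unique as soon as D is convex with nonempty
   interior. *)
Definition is_jacobian (R : realType) (p q : nat) (D : set 'cV[R]_p)
    (h : 'cV[R]_p -> 'cV[R]_q) (x : 'cV[R]_p) (J : 'M[R]_(q, p)) : Prop :=
  forall e : R, 0 < e -> \forall y \near within D (nbhs x),
    l2norm (h y - h x - J *m (y - x)) <= e * l2norm (y - x).

(* As r never takes the value -oo and 0 * +oo = 0 in \bar R, the right-hand side
   is the usual one, including for t = 0 and t = 1. *)
Definition econvex_on (R : realType) (p : nat) (D : set 'cV[R]_p)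
    (r : 'cV[R]_p -> \bar R) : Prop :=
  forall (x y : 'cV[R]_p) (t : R), D x -> D y -> 0 <= t <= 1 ->
    (r (t *: x + (1 - t) *: y)%R <= t%:E * r x + (1 - t)%:E * r y)%E.

Definition is_argmin (R : realType) (T : Type) (D : set T) (h : T -> \bar R)
    (x : T) : Prop :=
  D x /\ forall y, D y -> (h x <= h y)%E.

(* [oracle h x] is one evaluation of h at x.  A value of type [counted A] is a
   result together with the number of oracle calls made to compute it. *)
Definition counted (A : Type) : Type := (A * nat)%type.

Definition ret (A : Type) (v : A) : counted A := (v, 0%N).

Definition bind (A B : Type) (c : counted A) (h : A -> counted B) : counted B :=
  ((h c.1).1, (c.2 + (h c.1).2)%N).

Notation "x <~ c ;; e" := (bind c (fun x => e))
  (at level 61, c at next level, right associativity).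

Definition oracle (A B : Type) (h : A -> B) (x : A) : counted B := (h x, 1%N).

Definition caverage (R : realType) (V : lmodType R) (I : Type) (s : seq I)
    (c : I -> counted V) : counted V :=
  ((size s)%:R^-1 *: \sum_(i <- s) (c i).1, (\sum_(i <- s) (c i).2)%N).

Record problem (R : realType) (d k m n : nat) := Problem {
  feas : set 'cV[R]_d;
  outer : 'I_n -> 'cV[R]_k -> R;
  inner : 'I_m -> 'cV[R]_d -> 'cV[R]_k;
  jac : 'I_m -> 'cV[R]_d -> 'M[R]_(k, d);
  reg : 'cV[R]_d -> \bar R;
  prox : R -> 'cV[R]_d -> 'cV[R]_d }.

Section Problem.
Context {R : realType} {d k m n : nat} (pb : problem R d k m n).
Implicit Types (x : 'cV[R]_d) (eta : R).

Definition smooth_part x : R :=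
  n%:R^-1 * \sum_(i < n) outer pb i (m%:R^-1 *: \sum_(j < m) inner pb j x).

Definition objective x : \bar R := ((smooth_part x)%:E + reg pb x)%E.

(* The values of [inner], [jac] and [smooth_part] outside [feas] are irrelevant. *)
Record assumptions (Lf lf Lg lg : R) : Prop := Assumptions {
  feas_convex : convex_set (feas pb);
  feas_bounded : bounded_set (feas pb);
  outer_differentiable : forall i y,
    differentiable (outer pb i : 'cV[R]_k -> R^o) y;
  outer_grad_continuous : forall i, continuous (grad (outer pb i));
  inner_jacobian : forall j x, feas pb x ->
    is_jacobian (feas pb) (inner pb j) x (jac pb j x);
  inner_jacobian_continuous : forall j, {within feas pb, continuous (jac pb j)};
  reg_ninfty : forall x, (-oo < reg pb x)%E;
  reg_convex : econvex_on setT (reg pb);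
  reg_closed : lower_semicontinuous (reg pb);
  smooth_part_convex : convex_function (feas pb) smooth_part;
  prox_argmin : forall eta x, 0 < eta ->
    is_argmin (feas pb)
      (fun y => (reg pb y + ((2 * eta)^-1 * l2norm (y - x) ^+ 2)%:E)%E)
      (prox pb eta x);
  Lf_ge0 : 0 <= Lf;
  lf_ge0 : 0 <= lf;
  Lg_ge0 : 0 <= Lg;
  lg_ge0 : 0 <= lg;
  outer_lipschitz : forall i y z,
    `|outer pb i y - outer pb i z| <= Lf * l2norm (y - z);
  outer_grad_lipschitz : forall i y z,
    l2norm (grad (outer pb i) y - grad (outer pb i) z) <= lf * l2norm (y - z);
  inner_lipschitz : forall j x y, feas pb x -> feas pb y ->
    l2norm (inner pb j x - inner pb j y) <= Lg * l2norm (x - y);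
  inner_jacobian_lipschitz : forall j x y, feas pb x -> feas pb y ->
    specnorm (jac pb j x - jac pb j y) <= lg * l2norm (x - y) }.

End Problem.

Section SCVRG.
Context {R : realType} {d k m n a b : nat} (pb : problem R d k m n).
Variables (x0 : 'cV[R]_d) (k0 : nat) (eta : R) (S : nat).
(* [Aidx l] and [Bidx l] are the index collections sampled in the l-th inner
   iteration, where l = 0, 1, ... runs through all epochs. *)
Variables (Aidx : nat -> a.-tuple 'I_m) (Bidx : nat -> b.-tuple 'I_n).

Definition total_iterations : nat := (k0 * 2 ^ S - k0)%N.

Definition stepsize (l : nat) : R :=
  eta * Num.sqrt total_iterations%:R /
    Num.sqrt (2 * total_iterations%:R - l%:R).

Record snapshot := Snapshot {
  ref_point : 'cV[R]_d;
  ref_value : 'cV[R]_k;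
  ref_jac : 'M[R]_(k, d);
  ref_grad : 'cV[R]_d }.

Definition take_snapshot (xref : 'cV[R]_d) : counted snapshot :=
  gref <~ caverage (enum 'I_m) (fun j => oracle (inner pb j) xref) ;;
  zref <~ caverage (enum 'I_m) (fun j => oracle (jac pb j) xref) ;;
  u <~ caverage (enum 'I_n) (fun i => oracle (grad (outer pb i)) gref) ;;
  ret (Snapshot xref gref zref (zref^T *m u)).

Definition step (sn : snapshot) (l : nat) (x : 'cV[R]_d) : counted 'cV[R]_d :=
  dg <~ caverage (Aidx l) (fun j =>
    p <~ oracle (inner pb j) x ;;
    q <~ oracle (inner pb j) (ref_point sn) ;;
    ret (p - q)) ;;
  dz <~ caverage (Aidx l) (fun j =>
    p <~ oracle (jac pb j) x ;;
    q <~ oracle (jac pb j) (ref_point sn) ;;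
    ret (p - q)) ;;
  let gt := ref_value sn + dg in
  let zt := ref_jac sn + dz in
  dv <~ caverage (Bidx l) (fun i =>
    p <~ oracle (grad (outer pb i)) gt ;;
    q <~ oracle (grad (outer pb i)) (ref_value sn) ;;
    ret (zt^T *m p - (ref_jac sn)^T *m q)) ;;
  let vt := ref_grad sn + dv in
  ret (prox pb (stepsize l.+1) (x - stepsize l.+1 *: vt)).

Fixpoint iterate (sn : snapshot) (l : nat) (xstart : 'cV[R]_d) (t : nat) :
    counted 'cV[R]_d :=
  if t is t'.+1 then
    x <~ iterate sn l xstart t' ;; step sn (l + t') x
  else ret xstart.

Record state := State {
  st_ref : 'cV[R]_d;
  st_last : 'cV[R]_d;
  st_count : nat }.

(* The average of the iterates excludes the last one, which starts the next
   epoch; averaging stored iterates makes no oracle call. *)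
Definition epoch (K : nat) (st : state) : counted state :=
  sn <~ take_snapshot (st_ref st) ;;
  let x := iterate sn (st_count st) (st_last st) in
  xlast <~ x K ;;
  ret (State (K%:R^-1 *: \sum_(t < K) (x t).1) xlast (st_count st + K)).

Fixpoint epochs (s : nat) : counted state :=
  if s is s'.+1 then
    st <~ epochs s' ;; epoch (k0 * 2 ^ s') st
  else ret (State x0 x0 0).

Definition scvrg : counted 'cV[R]_d := st <~ epochs S ;; ret (st_ref st).

Definition scvrg_output : 'cV[R]_d := scvrg.1.
Definition scvrg_samples : nat := scvrg.2.

End SCVRG.

(* The joint law of all the indices drawn in iterations l < T is the product of
   the uniform laws on 'I_m and 'I_n: the draws are uniform, with replacement,
   and mutually independent. *)
Definition independent_uniform_draws (R : realType) (disp : measure_display)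
    (Omega : measurableType disp) (P : probability Omega R) (m n a b T : nat)
    (Aidx : Omega -> nat -> a.-tuple 'I_m)
    (Bidx : Omega -> nat -> b.-tuple 'I_n) : Prop :=
  forall (alpha : nat -> a.-tuple 'I_m) (beta : nat -> b.-tuple 'I_n),
    let E := [set w | forall l, (l < T)%N ->
                        Aidx w l = alpha l /\ Bidx w l = beta l] in
    measurable E /\ P E = ((m%:R ^+ a * n%:R ^+ b) ^- T)%:E.

Definition least_positive_nat_ge (R : realType) (x : R) (a : nat) : Prop :=
  [/\ (0 < a)%N, x <= a%:R &
      forall a' : nat, (0 < a')%N -> x <= a'%:R -> (a <= a')%N].

(* Main.v *)
Require Import Defs.
From HB Require Import structures.
From mathcomp Require Import all_boot all_order all_algebra.
From mathcomp Require Import all_classical all_reals all_analysis.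
From mathcomp Require Import ring lra zify.
Set Implicit Arguments.
Unset Strict Implicit.
Unset Printing Implicit Defensive.
Import Order.TTheory GRing.Theory Num.Theory.
Import numFieldNormedType.Exports.
Local Open Scope classical_set_scope.
Local Open Scope ring_scope.

(** Write w_l = 1 / (2 eta_l) for the inverse step sizes, delta_l for the squared
    distance of the l-th iterate x_l to xstar, Delta_l for its objective gap, and
    D = Dx, q = 6 DPhi + 15 ell D^2.  The proof is a Lyapunov argument on
    Delta_l + w_l delta_l.

    One proximal step along any vector v satisfies
      Delta_(l+1) + w_(l+1) delta_(l+1)
        <= w_(l+1) delta_l + <e, x_l - xstar> + |e|^2 / (4 (w_(l+1) - ell/2)),
    where e is the error of v as an estimate of the gradient of F
    ([prox_step_descent_proj]): the prox objective is strongly convex, F is convex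
    and its gradient is ell-Lipschitz.  For the sampled v, with reference point xr,
    the mean of the first error term is the bias, at most
    (ell / sqrt a) |x_l - xr| |x_l - xstar| ([grad_est_bias]), and the mean of |e|^2
    is at most ell^2 (1/b + 18/a) |x_l - xr|^2 ([grad_est_sqr]).  The prescribed
    batch sizes turn both together into at most eps / (15 D^2) times a weighted mean
    of delta_l and |xr - xstar|^2 ([avg_prox_update], [growth_rate]).

    The weights w_l decrease, so the terms w_l delta_l telescope with the right
    sign, and a discrete Gronwall argument ([epoch_gap_sum]) bounds the mean of
    delta_l by D^2 (1 + gam)^l with gam = (2/25) eps / q.  There are
    T <= 20 q / eps iterations, so this growth factor stays below an absolute
    constant ([growth_bound]).  All errors together are then at most a constant
    times q; the gaps of the last epoch sum to less than 5 q, while that epoch has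
    at least 5 q / eps iterations, and convexity passes the bound to the average of
    its iterates ([expected_gap], [final_bound]).  For S = 0 the tolerance exceeds
    DPhi and the starting point will do.

    Two points need care.  First, the spectral norm is not Euclidean, so the mean of
    a of the Jacobians has no dimension-free variance bound as a matrix; its variance
    is only taken after applying it to a fixed vector, where independence gives the
    factor 1/a.  Second, when X has empty interior the Jacobians are determined, and
    bounded by Lg, only along the span of X - X.  Differences of iterates lie in that
    span, so every error vector may first be projected onto it.

    The draws take finitely many values, so that expectations are averages over the
    tuples of all draws ([integral_observed]); the independence of the l-th draw from
    the past enters through [avg_resample].  Each epoch evaluates 2 m + n functions
    for its reference point and 4 a + 2 b per iteration ([epochs_cost]), and S and T
    are of order log(1/eps) and 1/eps ([sample_bound]). *)

(** * Euclidean and spectral norms *)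

Section Euclid.
Context {R : realType}.
Implicit Types p q : nat.

Definition dot p (u v : 'cV[R]_p) : R := \sum_i u i ord0 * v i ord0.

Lemma dotC p (u v : 'cV[R]_p) : dot u v = dot v u.
Proof. by apply: eq_bigr => i _; rewrite mulrC. Qed.

Lemma dotDl p (u v w : 'cV[R]_p) : dot (u + v) w = dot u w + dot v w.
Proof. by rewrite -big_split; apply: eq_bigr => i _; rewrite mxE mulrDl. Qed.

Lemma dotZl p (c : R) (u v : 'cV[R]_p) : dot (c *: u) v = c * dot u v.
Proof. by rewrite /dot mulr_sumr; apply: eq_bigr => i _; rewrite mxE mulrA. Qed.

Lemma dotDr p (u v w : 'cV[R]_p) : dot u (v + w) = dot u v + dot u w.
Proof. by rewrite dotC dotDl !(dotC u). Qed.

Lemma dotZr p (c : R) (u v : 'cV[R]_p) : dot u (c *: v) = c * dot u v.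
Proof. by rewrite dotC dotZl dotC. Qed.

Lemma dotNl p (u v : 'cV[R]_p) : dot (- u) v = - dot u v.
Proof. by rewrite -scaleN1r dotZl mulN1r. Qed.

Lemma dotNr p (u v : 'cV[R]_p) : dot u (- v) = - dot u v.
Proof. by rewrite dotC dotNl dotC. Qed.

Lemma dotBl p (u v w : 'cV[R]_p) : dot (u - v) w = dot u w - dot v w.
Proof. by rewrite dotDl dotNl. Qed.

Lemma dotBr p (u v w : 'cV[R]_p) : dot u (v - w) = dot u v - dot u w.
Proof. by rewrite dotDr dotNr. Qed.

Lemma dot0l p (u : 'cV[R]_p) : dot 0 u = 0.
Proof. by rewrite -(scale0r 0) dotZl mul0r. Qed.

Lemma dot0r p (u : 'cV[R]_p) : dot u 0 = 0.
Proof. by rewrite dotC dot0l. Qed.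

Lemma dot_suml p (I : Type) (s : seq I) (F : I -> 'cV[R]_p) (v : 'cV[R]_p) :
  dot (\sum_(i <- s) F i) v = \sum_(i <- s) dot (F i) v.
Proof.
by elim: s => [|i s IH]; rewrite ?big_nil ?dot0l // !big_cons dotDl IH.
Qed.

Lemma dot_sumr p (I : Type) (s : seq I) (F : I -> 'cV[R]_p) (v : 'cV[R]_p) :
  dot v (\sum_(i <- s) F i) = \sum_(i <- s) dot v (F i).
Proof. by rewrite dotC dot_suml; apply: eq_bigr => i _; rewrite dotC. Qed.

Lemma dot_ge0 p (u : 'cV[R]_p) : 0 <= dot u u.
Proof. by apply: sumr_ge0 => i _; rewrite -expr2 sqr_ge0. Qed.

Lemma dot_eq0 p (u : 'cV[R]_p) : dot u u = 0 -> u = 0.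
Proof.
move=> /eqP; rewrite psumr_eq0 => [/allP u0|i _]; last by rewrite -expr2 sqr_ge0.
apply/colP => i; rewrite mxE; apply/eqP.
by have := u0 i (mem_index_enum i); rewrite /= mulf_eq0 orbb.
Qed.

Lemma dot_trmx p q (A : 'M[R]_(p, q)) (c : 'cV[R]_p) (u : 'cV[R]_q) :
  dot (A^T *m c) u = dot c (A *m u).
Proof.
rewrite /dot; under eq_bigr do rewrite mxE mulr_suml.
rewrite exchange_big; apply: eq_bigr => i _; rewrite mxE mulr_sumr.
by apply: eq_bigr => j _; rewrite mxE mulrCA mulrA.
Qed.

Lemma l2norm_sqr p (u : 'cV[R]_p) : l2norm u ^+ 2 = dot u u.
Proof.
rewrite sqr_sqrtr; first by apply: eq_bigr => i _; rewrite expr2.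
by apply: sumr_ge0 => i _; rewrite sqr_ge0.
Qed.

Lemma l2norm_ge0 p (u : 'cV[R]_p) : 0 <= l2norm u.
Proof. exact: sqrtr_ge0. Qed.

Lemma l2norm0 p : l2norm (0 : 'cV[R]_p) = 0.
Proof. by apply/eqP; rewrite -sqrf_eq0 l2norm_sqr dot0l. Qed.

Lemma l2norm_eq0 p (u : 'cV[R]_p) : l2norm u = 0 -> u = 0.
Proof. by move=> u0; apply: dot_eq0; rewrite -l2norm_sqr u0 expr0n. Qed.

Lemma l2normZ p (c : R) (u : 'cV[R]_p) : l2norm (c *: u) = `|c| * l2norm u.
Proof.
apply/eqP; rewrite -(@eqrXn2 _ 2) ?mulr_ge0 ?l2norm_ge0 //.
by rewrite exprMn !l2norm_sqr dotZl dotZr mulrA real_normK ?num_real.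
Qed.

Lemma l2normN p (u : 'cV[R]_p) : l2norm (- u) = l2norm u.
Proof. by rewrite -scaleN1r l2normZ normrN1 mul1r. Qed.

Lemma l2normBC p (u v : 'cV[R]_p) : l2norm (u - v) = l2norm (v - u).
Proof. by rewrite -l2normN opprB. Qed.

Lemma l2norm_sqrD p (u v : 'cV[R]_p) :
  l2norm (u + v) ^+ 2 = l2norm u ^+ 2 + 2 * dot u v + l2norm v ^+ 2.
Proof. rewrite !l2norm_sqr dotDl !dotDr (dotC v u); ring. Qed.

Lemma ler_l2norm p (u : 'cV[R]_p) (c : R) :
  0 <= c -> l2norm u ^+ 2 <= c ^+ 2 -> l2norm u <= c.
Proof. by move=> c0; rewrite ler_sqr // nnegrE l2norm_ge0. Qed.

Lemma cauchy_schwarz p (u v : 'cV[R]_p) : dot u v <= l2norm u * l2norm v.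
Proof.
have [v0|v0] := eqVneq (l2norm v) 0.
  by rewrite (l2norm_eq0 v0) dot0r l2norm0 mulr0.
have vp : 0 < dot v v by rewrite -l2norm_sqr exprn_gt0 // lt0r v0 l2norm_ge0.
apply: (le_trans (ler_norm _)).
rewrite -ler_sqr ?nnegrE ?mulr_ge0 ?l2norm_ge0 //.
rewrite real_normK ?num_real // exprMn !l2norm_sqr.
have := dot_ge0 (dot v v *: u - dot u v *: v).
rewrite dotBl !dotBr !dotZl !dotZr (dotC v u).
rewrite [leRHS](_ : _ = dot v v * (dot u u * dot v v - dot u v ^+ 2)); last by ring.
by rewrite pmulr_rge0 // subr_ge0.
Qed.

Lemma cauchy_schwarz_abs p (u v : 'cV[R]_p) : `|dot u v| <= l2norm u * l2norm v.
Proof.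
rewrite ler_norml cauchy_schwarz andbT lerNl -dotNl -(l2normN u).
exact: cauchy_schwarz.
Qed.

Lemma ler_l2normD p (u v : 'cV[R]_p) : l2norm (u + v) <= l2norm u + l2norm v.
Proof.
rewrite -ler_sqr ?nnegrE ?addr_ge0 ?l2norm_ge0 // l2norm_sqrD.
have := cauchy_schwarz u v; lra.
Qed.

Lemma ler_l2normB p (u v : 'cV[R]_p) : l2norm (u - v) <= l2norm u + l2norm v.
Proof. by rewrite (le_trans (ler_l2normD _ _)) // l2normN. Qed.

Lemma l2norm_dist_triangle p (u v w : 'cV[R]_p) :
  l2norm (u - w) <= l2norm (u - v) + l2norm (v - w).
Proof. by rewrite -(subrKA v) ler_l2normD. Qed.

Lemma l2norm_sqrD_le p (u v : 'cV[R]_p) :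
  l2norm (u + v) ^+ 2 <= 2 * l2norm u ^+ 2 + 2 * l2norm v ^+ 2.
Proof.
rewrite l2norm_sqrD; have := sqr_ge0 (l2norm u - l2norm v).
have := cauchy_schwarz u v; rewrite sqrrB; lra.
Qed.

Lemma ler_l2norm_sum p (I : Type) (s : seq I) (F : I -> 'cV[R]_p) :
  l2norm (\sum_(i <- s) F i) <= \sum_(i <- s) l2norm (F i).
Proof.
elim: s => [|i s IH]; rewrite ?big_nil ?l2norm0 // !big_cons.
by rewrite (le_trans (ler_l2normD _ _)) // lerD2l.
Qed.

(** Cancel one factor of the norm; the zero vector is a case apart. *)
Lemma dot_l2norm_le p (u : 'cV[R]_p) (c : R) :
  0 <= c -> dot u u <= c * l2norm u -> l2norm u <= c.
Proof.
move=> c0; rewrite -l2norm_sqr expr2.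
have [->|u0] := eqVneq (l2norm u) 0; first by [].
by rewrite ler_pM2r // lt0r u0 l2norm_ge0.
Qed.

(** The supremum defining the spectral norm is finite because the norms of the rows
    of A bound A on the unit ball, by Cauchy-Schwarz. *)
Lemma specnorm_mul p q (A : 'M[R]_(p, q)) (u : 'cV[R]_q) :
  l2norm (A *m u) <= specnorm A * l2norm u.
Proof.
have [u0|u0] := eqVneq (l2norm u) 0.
  by rewrite (l2norm_eq0 u0) mulmx0 !l2norm0 mulr0.
have up : 0 < l2norm u by rewrite lt0r u0 l2norm_ge0.
rewrite -ler_pdivrMr // mulrC.
rewrite -[X in X * _](@ger0_norm _ (l2norm u)^-1) ?invr_ge0 ?l2norm_ge0 //.
rewrite -l2normZ scalemxAr; apply: ub_le_sup; last first.
  exists ((l2norm u)^-1 *: u) => //=.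
  by rewrite l2normZ ger0_norm ?invr_ge0 ?l2norm_ge0 // mulVf.
exists (Num.sqrt (\sum_i l2norm ((row i A)^T) ^+ 2)) => _ [v /= v1 <-].
apply: ler_l2norm => //; rewrite l2norm_sqr sqr_sqrtr; last first.
  by apply: sumr_ge0 => i _; rewrite sqr_ge0.
apply: ler_sum => i _.
have -> : (A *m v) i ord0 = dot ((row i A)^T) v.
  by rewrite mxE; apply: eq_bigr => j _; rewrite !mxE.
rewrite -expr2 -[leLHS]real_normK ?num_real // ler_sqr ?nnegrE ?l2norm_ge0 //.
rewrite (le_trans (cauchy_schwarz_abs _ _)) //.
by rewrite -[leRHS]mulr1 ler_wpM2l ?l2norm_ge0.
Qed.

Lemma opbound_trmx p q (A : 'M[R]_(p, q)) (c : R) : 0 <= c ->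
  (forall u, l2norm (A *m u) <= c * l2norm u) ->
  forall v, l2norm (A^T *m v) <= c * l2norm v.
Proof.
move=> c0 Ac v; apply: dot_l2norm_le; first by rewrite mulr_ge0 ?l2norm_ge0.
rewrite dot_trmx (le_trans (cauchy_schwarz _ _)) //.
by rewrite mulrAC mulrC ler_wpM2r ?l2norm_ge0 //.
Qed.

End Euclid.

(** * Averages and sampling with replacement *)

Section Averages.
Context {R : realType}.

(** Expectation under the uniform law. *)
Definition avg (T : finType) (F : T -> R) : R := #|T|%:R^-1 * \sum_x F x.

Lemma eq_avg (T : finType) (F G : T -> R) : F =1 G -> avg F = avg G.
Proof. by move=> FG; rewrite /avg; under eq_bigr do rewrite FG. Qed.

Lemma avgD (T : finType) (F G : T -> R) :
  avg (fun x => F x + G x) = avg F + avg G.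
Proof. by rewrite /avg big_split mulrDr. Qed.

Lemma avgZ (T : finType) (c : R) (F : T -> R) :
  avg (fun x => c * F x) = c * avg F.
Proof. by rewrite /avg -mulr_sumr mulrCA. Qed.

Lemma avgZr (T : finType) (c : R) (F : T -> R) :
  avg (fun x => F x * c) = avg F * c.
Proof. by rewrite mulrC -avgZ; apply: eq_avg => x; rewrite mulrC. Qed.

Lemma avgN (T : finType) (F : T -> R) : avg (fun x => - F x) = - avg F.
Proof. by rewrite -mulN1r -avgZ; apply: eq_avg => x; rewrite mulN1r. Qed.

Lemma avg_sum (T : finType) (I : Type) (s : seq I) (F : I -> T -> R) :
  avg (fun x => \sum_(i <- s) F i x) = \sum_(i <- s) avg (F i).
Proof. by rewrite /avg exchange_big mulr_sumr. Qed.

Lemma avg_cst (T : finType) (c : R) : (0 < #|T|)%N -> avg (fun _ : T => c) = c.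
Proof.
move=> T0; rewrite /avg sumr_const -[c *+ _]mulr_natl mulKf //.
by rewrite pnatr_eq0 -lt0n.
Qed.

Lemma ler_avg (T : finType) (F G : T -> R) :
  (forall x, F x <= G x) -> avg F <= avg G.
Proof.
by move=> FG; rewrite /avg ler_wpM2l ?invr_ge0 // ler_sum.
Qed.

Lemma avg_le_cst (T : finType) (F : T -> R) (c : R) : (0 < #|T|)%N ->
  (forall x, F x <= c) -> avg F <= c.
Proof. by move=> T0 Fc; rewrite -[leRHS](avg_cst c T0) ler_avg. Qed.

Lemma avg_ge0 (T : finType) (F : T -> R) : (forall x, 0 <= F x) -> 0 <= avg F.
Proof. by move=> F0; rewrite /avg mulr_ge0 ?invr_ge0 // sumr_ge0. Qed.

Lemma avg_pair (T U : finType) (F : T * U -> R) :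
  avg F = avg (fun x => avg (fun y => F (x, y))).
Proof.
rewrite /avg -mulr_sumr mulrA card_prod natrM invfM; congr (_ * _).
by rewrite pair_bigA /=; apply: eq_bigr => -[x y] _.
Qed.

(** Jensen's inequality for the square, from the nonnegativity of the variance. *)
Lemma avg_le_of_sqr (T : finType) (F : T -> R) (c : R) : (0 < #|T|)%N ->
  0 <= c -> avg (fun x => F x ^+ 2) <= c ^+ 2 -> avg F <= c.
Proof.
move=> T0 c0 Fc; have := avg_ge0 (fun x => sqr_ge0 (F x - avg F)).
under eq_avg do rewrite sqrrB.
rewrite avgD avg_cst // avgD avgN.
under [X in _ - X]eq_avg => x do rewrite -mulr_natl mulrA.
rewrite avgZr avgZ => H.
have [F0|/ltW F0] := leP (avg F) 0; first exact: le_trans F0 c0.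
rewrite -ler_sqr ?nnegrE //; apply: le_trans Fc.
by move: H; rewrite expr2 => H; nra.
Qed.

End Averages.

Section Sampling.
Context {R : realType}.

Definition tset (D : Type) n (i : 'I_n) (x : D) (s : n.-tuple D) : n.-tuple D :=
  [tuple if j == i then x else tnth s j | j < n].

(** The i-th draw is independent of whatever ignores it: exchanging it with a fresh
    draw is an involution on the pairs of a sample and a fresh draw. *)
Lemma avg_resample (D : finType) n (i : 'I_n) (Q : n.-tuple D -> D -> R) :
  (0 < #|D|)%N -> (forall s x y, Q (tset i y s) x = Q s x) ->
  avg (fun s => Q s (tnth s i)) = avg (fun s => avg (Q s)).
Proof.
move=> D0 Qi; rewrite /avg; congr (_ * _); rewrite -mulr_sumr.
have N0 : #|D|%:R != 0 :> R by rewrite pnatr_eq0 -lt0n.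
apply: (mulfI N0); rewrite mulVKf // pair_bigA /=.
pose swap (u : n.-tuple D * D) := (tset i u.2 u.1, tnth u.1 i).
have swapK : involutive swap.
  move=> [s x]; congr pair; last by rewrite tnth_mktuple eqxx.
  by apply: eq_from_tnth => j; rewrite !tnth_mktuple; case: eqP => // ->.
rewrite (reindex_inj (inv_inj swapK)) /=.
rewrite (eq_bigr (fun u => Q u.1 (tnth u.1 i))); last by move=> u _; exact: Qi.
rewrite -(pair_bigA _ (fun s (_ : D) => Q s (tnth s i))) /= mulr_sumr.
by apply: eq_bigr => s _; rewrite sumr_const mulr_natl.
Qed.

Lemma avg_tnth (D : finType) n (i : 'I_n) (h : D -> R) : (0 < #|D|)%N ->
  avg (fun s : n.-tuple D => h (tnth s i)) = avg h.
Proof.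
move=> D0; rewrite (@avg_resample D n i (fun=> h)) // avg_cst //.
by rewrite card_tuple expn_gt0 D0.
Qed.

Definition smean (V : lmodType R) (D : Type) n (Y : D -> V) (A : n.-tuple D) : V :=
  n%:R^-1 *: \sum_(j <- A) Y j.

Definition vmean (V : lmodType R) (D : finType) (Y : D -> V) : V :=
  #|D|%:R^-1 *: \sum_j Y j.

Section Vectors.
Context {p n : nat} {D : finType} (D0 : (0 < #|D|)%N) (n0 : (0 < n)%N).
Implicit Types (Y : D -> 'cV[R]_p) (A : n.-tuple D).

Lemma dot_vmean Y u : dot u (vmean Y) = avg (fun j => dot u (Y j)).
Proof. by rewrite /vmean dotZr dot_sumr. Qed.

Lemma dot_smean Y A u :
  dot u (smean Y A) = n%:R^-1 * \sum_(i < n) dot u (Y (tnth A i)).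
Proof. by rewrite /smean dotZr dot_sumr big_tuple. Qed.

Lemma avg_dot_smean Y u :
  avg (fun A => dot u (smean Y A)) = dot u (vmean Y).
Proof.
under eq_avg do rewrite dot_smean.
rewrite avgZ avg_sum dot_vmean.
under eq_bigr do rewrite (avg_tnth _ (fun j => dot u (Y j))) //.
rewrite sumr_const card_ord -dot_vmean -[dot _ _ *+ n]mulr_natl mulKf //.
by rewrite pnatr_eq0 -lt0n.
Qed.

(** Distinct entries of the sample are independent and centered, so that only
    the n diagonal terms of the square of the mean survive. *)
Lemma smean_centered_sqr Y : vmean Y = 0 ->
  avg (fun A => l2norm (smean Y A) ^+ 2) = n%:R^-1 * avg (fun j => l2norm (Y j) ^+ 2).
Proof.
move=> Y0.
have nn0 : n%:R != 0 :> R by rewrite pnatr_eq0 -lt0n.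
transitivity (avg (fun A : n.-tuple D => n%:R^-1 * (n%:R^-1 *
    \sum_(i < n) \sum_(k < n) dot (Y (tnth A i)) (Y (tnth A k))))).
  apply: eq_avg => A; rewrite l2norm_sqr dot_smean; congr (_ * _).
  rewrite mulr_sumr; apply: eq_bigr => i _; rewrite dotC dot_smean //.
rewrite !avgZ avg_sum; congr (_ * _).
rewrite (eq_bigr (fun=> avg (fun j => l2norm (Y j) ^+ 2))).
  by rewrite sumr_const card_ord -[avg _ *+ n]mulr_natl mulKf.
move=> i _; rewrite avg_sum (bigD1 i) //= big1 ?addr0.
  under eq_avg do rewrite -l2norm_sqr.
  exact: (avg_tnth i (fun j => l2norm (Y j) ^+ 2)).
move=> k ki; rewrite (@avg_resample _ _ k (fun A j => dot (Y (tnth A i)) (Y j))) //.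
  under eq_avg do rewrite -dot_vmean Y0 dot0r.
  by rewrite avg_cst // card_tuple expn_gt0 D0.
by move=> A j y; rewrite tnth_mktuple eq_sym (negPf ki).
Qed.

(** Bias-variance decomposition of the mean of a sample. *)
Lemma smean_sqr Y c :
  avg (fun A => l2norm (c + smean Y A) ^+ 2) <=
  l2norm (c + vmean Y) ^+ 2 + n%:R^-1 * avg (fun j => l2norm (Y j) ^+ 2).
Proof.
have nn0 : n%:R != 0 :> R by rewrite pnatr_eq0 -lt0n.
have T0 : (0 < #|{: n.-tuple D}|)%N by rewrite card_tuple expn_gt0 D0.
pose Z j := Y j - vmean Y.
have Z0 : vmean Z = 0.
  rewrite {1}/vmean sumrB sumr_const scalerBr -[vmean Y *+ _]scaler_nat scalerA.
  by rewrite mulVf ?scale1r ?subrr // pnatr_eq0 -lt0n.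
have YZ A : c + smean Y A = (c + vmean Y) + smean Z A.
  rewrite /smean sumrB big_const_seq count_predT size_tuple iter_addr_0.
  rewrite scalerBr -[vmean Y *+ n]scaler_nat (scalerA _ _ (vmean Y)) mulVf //.
  by rewrite scale1r addrACA subrr addr0.
under eq_avg do rewrite YZ l2norm_sqrD.
rewrite !avgD avg_cst // avgZ avg_dot_smean Z0 dot0r mulr0 addr0 lerD2l.
rewrite smean_centered_sqr // ler_wpM2l ?invr_ge0 //.
rewrite (eq_avg (G := fun j => l2norm (Y j) ^+ 2 + - (2 * dot (vmean Y) (Y j)) +
  l2norm (vmean Y) ^+ 2)); last first.
  by move=> j; rewrite /Z l2norm_sqrD l2normN dotNr dotC mulrN.
rewrite avgD avg_cst // avgD avgN avgZ -dot_vmean -l2norm_sqr.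
have := sqr_ge0 (l2norm (vmean Y)); lra.
Qed.

Lemma smean_variance Y (s : R) :
  (forall j, l2norm (Y j) <= s) ->
  avg (fun A => l2norm (smean Y A - vmean Y) ^+ 2) <= s ^+ 2 / n%:R.
Proof.
move=> Ys; under eq_avg do rewrite addrC.
rewrite (le_trans (smean_sqr _ _)) // addNr l2norm0 expr0n add0r mulrC.
rewrite ler_wpM2r ?invr_ge0 //; apply: avg_le_cst => // j.
by rewrite lerXn2r ?nnegrE ?l2norm_ge0 // (le_trans (l2norm_ge0 _) (Ys j)).
Qed.

End Vectors.
End Sampling.

(** * Second-order expansion along a segment *)

Section Line.
Context {R : realType}.
Implicit Types (phi psi : R -> R) (a b c t s : R).

Lemma le_of_small a b c :
  (forall t, 0 < t -> t <= 1 -> a <= b + t * c) -> a <= b.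
Proof.
move=> H; apply/ler_addgt0Pr => e e0.
have [c0|c0] := leP c 0.
  by apply: (le_trans (H 1 ltr01 (lexx _))); rewrite lerD2l mul1r (le_trans c0 (ltW e0)).
have t0 : 0 < Num.min 1 (e / c) by rewrite lt_min ltr01 divr_gt0.
apply: (le_trans (H _ t0 _)); first by rewrite ge_min lexx.
rewrite lerD2l.
by rewrite -ler_pdivlMr // ge_min lexx orbT.
Qed.

(** Differentiability on the segment [0, 1], one-sided at its ends, as befits maps
    that are controlled on a convex set only. *)
Definition line_derivative phi psi : Prop :=
  forall t, 0 <= t <= 1 -> forall e, 0 < e ->
  exists2 del, 0 < del & forall s, 0 <= s <= 1 -> `|s - t| <= del ->
    `|phi s - phi t - psi t * (s - t)| <= e * `|s - t|.

(** Real induction. The bound with an extra slope e holds on a set of times whose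
    supremum belongs to it and, if less than 1, could be exceeded; then e tends to 0. *)
Lemma line_upper phi psi c : line_derivative phi psi -> 0 <= c ->
  (forall t, 0 <= t <= 1 -> psi t <= psi 0 + c * t) ->
  phi 1 <= phi 0 + psi 0 + c / 2.
Proof.
move=> dphi c0 psic; apply/ler_addgt0Pr => e e0.
pose h t := phi 0 + psi 0 * t + c / 2 * t ^+ 2 + e * t.
pose A := [set t | 0 <= t <= 1 /\ phi t <= h t].
suff : phi 1 <= h 1 by rewrite /h expr1n !mulr1.
have A0 : A 0 by split; rewrite ?lexx ?ler01 // /h expr0n !mulr0 !addr0.
have supA : has_sup A.
  by split; [exists 0 | exists 1 => t [/andP[]]].
set z := sup A.
have z01 : 0 <= z <= 1.
  apply/andP; split; first exact: (ub_le_sup (proj2 supA)).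
  by apply: ge_sup; [exists 0 | move=> t [/andP[]]].
have e2 : 0 < e / 2 by rewrite divr_gt0.
have [del0 del0_gt0 Hdel0] := dphi z z01 _ e2.
have c1 : 0 < c + 1 by lra.
pose del := Num.min del0 (e / (c + 1)).
have del_gt0 : 0 < del by rewrite lt_min del0_gt0 divr_gt0.
have delc : c * del <= e.
  have : (c + 1) * del <= e by rewrite mulrC -ler_pdivlMr // ge_min lexx orbT.
  nra.
have Hdel s : 0 <= s <= 1 -> `|s - z| <= del ->
    `|phi s - phi z - psi z * (s - z)| <= e / 2 * `|s - z|.
  by move=> s01 sz; apply: Hdel0 => //; rewrite (le_trans sz) // ge_min lexx.
have psiz := psic z z01.
(* The supremum belongs to A, approaching it from the left. *)
have hz : phi z <= h z.
  have [s [s01 hs] zs] := sup_adherent del_gt0 supA.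
  have sz : s <= z by apply: (ub_le_sup (proj2 supA)).
  have := Hdel s s01; rewrite ler0_norm ?subr_le0 // => /(_ _)/ler_normlP[].
    by move: zs; rewrite -/z; lra.
  move=> H1 _; rewrite /h in hs *; move: zs; rewrite -/z => zs.
  have d0 : 0 <= z - s by lra.
  have H4 : c * (z - s) <= e.
    by apply: le_trans delc; rewrite ler_wpM2l //; lra.
  have H5 : psi z * (z - s) <= (psi 0 + c * z) * (z - s) by rewrite ler_wpM2r.
  have H6 : c * (z - s) * (z - s) <= e * (z - s) by rewrite ler_wpM2r.
  nra.
have [z1|z1] := leP 1 z.
  by have <- : z = 1 by case/andP: z01 => _ z1'; apply/eqP; rewrite eq_le z1' z1.
(* Otherwise A would extend beyond its supremum. *)
pose u := Num.min del (1 - z).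
have u0 : 0 < u by rewrite lt_min del_gt0 subr_gt0.
have ud : u <= del by rewrite ge_min lexx.
have u1 : u <= 1 - z by rewrite ge_min lexx orbT.
have zu01 : 0 <= z + u <= 1 by case/andP: z01 => ? ?; apply/andP; split; lra.
suff : A (z + u) by move=> /(ub_le_sup (proj2 supA)); rewrite -/z; lra.
split => //.
have := Hdel (z + u) zu01; have -> : z + u - z = u by lra.
rewrite gtr0_norm // => /(_ ud)/ler_normlP[_]; move: hz; rewrite /h => H1 H2.
have H5 : psi z * u <= (psi 0 + c * z) * u by rewrite ler_wpM2r // ltW.
have H6 : 0 <= c * u * u by rewrite !mulr_ge0 // ltW.
nra.
Qed.

Lemma line_quadratic phi psi c : line_derivative phi psi -> 0 <= c ->
  (forall t, 0 <= t <= 1 -> `|psi t - psi 0| <= c * t) ->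
  `|phi 1 - phi 0 - psi 0| <= c / 2.
Proof.
move=> dphi c0 psic.
have up : phi 1 <= phi 0 + psi 0 + c / 2.
  apply: line_upper => // t /psic /ler_normlP[_]; lra.
have dN : line_derivative (fun t => - phi t) (fun t => - psi t).
  move=> t t01 e e0; have [del del0 H] := dphi t t01 e e0.
  exists del => // s s01 st; rewrite -normrN; apply: le_trans (H s s01 st).
  by rewrite le_eqVlt; apply/orP; left; apply/eqP; congr `| _ |; ring.
have lo := line_upper dN c0.
have {}lo : - phi 1 <= - phi 0 - psi 0 + c / 2.
  by apply: lo => t /psic /ler_normlP[+ _]; lra.
by apply/ler_normlP; split; lra.
Qed.

End Line.

(** * Gradients and Jacobians *)

Section Smoothness.
Context {R : realType}.

Definition segment_closed p (D : set 'cV[R]_p) : Prop :=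
  forall x y t, D x -> D y -> 0 <= t <= 1 -> D (x + t *: (y - x)).

Lemma convex_segment p (D : set 'cV[R]_p) : convex_set D -> segment_closed D.
Proof.
move=> cD x y t Dx Dy /andP[t0 t1].
have /set_mem : t *: y + (1 - t) *: x \in D.
  exact: (cD y x (Itv01 t0 t1) (mem_set Dy) (mem_set Dx)).
congr D; rewrite scalerBr scalerBl scale1r.
by rewrite addrC -!addrA; congr (_ + _); rewrite addrC.
Qed.

Lemma derive_grad p (h : 'cV[R]_p -> R) (x u : 'cV[R]_p) :
  differentiable (h : 'cV[R]_p -> R^o) x ->
  'D_u (h : 'cV[R]_p -> R^o) x = dot (grad h x) u.
Proof.
move=> dh; rewrite deriveE //.
have {1}-> : u = \sum_i u i ord0 *: delta_mx i ord0.
  rewrite [LHS]matrix_sum_delta; apply: eq_bigr => i _.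
  by rewrite big_ord1.
rewrite linear_sum; apply: eq_bigr => i _.
by rewrite linearZ /= mxE deriveE // mulrC.
Qed.

Lemma grad_line p (h : 'cV[R]_p -> R) (x u : 'cV[R]_p) :
  (forall y, differentiable (h : 'cV[R]_p -> R^o) y) ->
  line_derivative (fun t => h (x + t *: u)) (fun t => dot (grad h (x + t *: u)) u).
Proof.
move=> dh t _ e e0.
have dv : derivable (h : 'cV[R]_p -> R^o) (x + t *: u) u by exact: diff_derivable.
have /cvgrPdist_le /(_ e e0) := dv.
rewrite -/(derive _ _ _) derive_grad // => /nbhs_ballP[r /= r0 Hr].
exists (r / 2) => [|s _ st]; first by rewrite divr_gt0.
have [->|nst] := eqVneq s t; first by rewrite !subrr mulr0 subr0 normr0 mulr0.
have st0 : s - t != 0 by rewrite subr_eq0.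
have := Hr (s - t); rewrite /ball /= sub0r normrN => /(_ _ st0).
have -> : (s - t) *: u + (x + t *: u) = x + s *: u.
  by rewrite addrCA -scalerDl subrK.
move=> H; have {}H := H (le_lt_trans st _).
have {}H := H ltac:(by rewrite ltr_pdivrMr // ltr_pMr // ltr1n).
rewrite -ler_pdivrMr ?normr_gt0 // -normf_div -normrN.
apply: le_trans H; rewrite le_eqVlt; apply/orP; left; apply/eqP; congr `| _ |.
by rewrite /GRing.scale /=; field.
Qed.

Lemma grad_quadratic p (h : 'cV[R]_p -> R) (l : R) :
  (forall y, differentiable (h : 'cV[R]_p -> R^o) y) -> 0 <= l ->
  (forall y z, l2norm (grad h y - grad h z) <= l * l2norm (y - z)) ->
  forall x y, `|h y - h x - dot (grad h x) (y - x)| <= l / 2 * l2norm (y - x) ^+ 2.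
Proof.
move=> dh l0 lh x y.
have := line_quadratic (c := l * l2norm (y - x) ^+ 2) (grad_line x (y - x) dh).
rewrite scale1r !scale0r addr0 subrKC => H; rewrite [leRHS]mulrAC; apply: H.
  by rewrite mulr_ge0 ?sqr_ge0.
move=> t /andP[t0 _]; rewrite -dotBl (le_trans (cauchy_schwarz_abs _ _)) //.
have := lh (x + t *: (y - x)) x; rewrite addrAC subrr add0r l2normZ ger0_norm //.
have := l2norm_ge0 (y - x); set a := l2norm _; set b := l2norm _; nra.
Qed.

(** Compare the first-order expansion along the gradient itself with the Lipschitz
    bound, and let the step tend to 0. *)
Lemma grad_bound p (h : 'cV[R]_p -> R) (L l : R) :
  (forall y, differentiable (h : 'cV[R]_p -> R^o) y) -> 0 <= L -> 0 <= l ->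
  (forall y z, `|h y - h z| <= L * l2norm (y - z)) ->
  (forall y z, l2norm (grad h y - grad h z) <= l * l2norm (y - z)) ->
  forall x, l2norm (grad h x) <= L.
Proof.
move=> dh L0 l0 Lh lh x; apply: dot_l2norm_le => //; set u := grad h x.
apply: (@le_of_small _ _ _ (l / 2 * l2norm u ^+ 2)) => t t0 t1.
have xu : x + t *: u - x = t *: u by rewrite addrAC subrr add0r.
have := grad_quadratic dh l0 lh x (x + t *: u).
have := Lh (x + t *: u) x.
rewrite xu -/u l2normZ dotZr (gtr0_norm t0) => /ler_normlP[_ H1] /ler_normlP[H2 _].
rewrite -(ler_pM2l t0); nra.
Qed.

Lemma jacobian_line p q (D : set 'cV[R]_p) (h : 'cV[R]_p -> 'cV[R]_q)
    (J : 'cV[R]_p -> 'M[R]_(q, p)) (x y : 'cV[R]_p) (c : 'cV[R]_q) :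
  segment_closed D -> (forall z, D z -> is_jacobian D h z (J z)) -> D x -> D y ->
  line_derivative (fun t => dot c (h (x + t *: (y - x))))
    (fun t => dot c (J (x + t *: (y - x)) *m (y - x))).
Proof.
move=> cD dh Dx Dy t t01 e e0; set u := y - x.
pose e' := e / (l2norm c * l2norm u + 1).
have c0 : 0 <= l2norm c * l2norm u by rewrite mulr_ge0 ?l2norm_ge0.
have e'0 : 0 < e' by rewrite divr_gt0 // ltr_wpDl.
have := dh _ (cD _ _ _ Dx Dy t01) e' e'0; rewrite /within /= -/u.
move=> /nbhs_ballP[r /= r0 Hr].
have n1 : 0 < `|u| + 1 by rewrite ltr_wpDl.
exists (r / 2 / (`|u| + 1)) => [|s s01 st]; first by rewrite !divr_gt0.
have dst : x + s *: u - (x + t *: u) = (s - t) *: u.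
  by rewrite opprD addrACA subrr add0r -scalerBl.
have := Hr (x + s *: u).
rewrite -ball_normE /ball_ /= -normrN opprB dst normrZ.
have st' : `|s - t| * `|u| < r.
  move: st; rewrite ler_pdivlMr // => st.
  have := normr_ge0 (s - t); nra.
move=> /(_ st' (cD _ _ _ Dx Dy s01)); rewrite l2normZ => H.
have -> : dot c (h (x + s *: u)) - dot c (h (x + t *: u)) -
    dot c (J (x + t *: u) *m u) * (s - t) =
    dot c (h (x + s *: u) - h (x + t *: u) - J (x + t *: u) *m ((s - t) *: u)).
  by rewrite -scalemxAr !dotBr dotZr [_ * (s - t)]mulrC.
apply: (le_trans (cauchy_schwarz_abs _ _)).
apply: (le_trans (ler_wpM2l (l2norm_ge0 c) H)).
rewrite [leLHS](_ : _ = `|s - t| * (e' * (l2norm c * l2norm u))); last by ring.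
rewrite [leRHS]mulrC ler_wpM2l //.
by rewrite /e' mulrAC ler_pdivrMr ?ltr_wpDl // ler_wpM2l ?(ltW e0) // lerDl.
Qed.

(** Testing the remainder against itself reduces the claim to a scalar function on a
    segment. *)
Lemma jacobian_quadratic p q (D : set 'cV[R]_p) (h : 'cV[R]_p -> 'cV[R]_q)
    (J : 'cV[R]_p -> 'M[R]_(q, p)) (l : R) :
  segment_closed D -> (forall z, D z -> is_jacobian D h z (J z)) -> 0 <= l ->
  (forall x y, D x -> D y -> specnorm (J x - J y) <= l * l2norm (x - y)) ->
  forall x y, D x -> D y ->
    l2norm (h y - h x - J x *m (y - x)) <= l / 2 * l2norm (y - x) ^+ 2.
Proof.
move=> cD dh l0 lJ x y Dx Dy; set c := _ - _ *m _.
apply: dot_l2norm_le; first by rewrite mulr_ge0 ?sqr_ge0 // divr_ge0.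
have := line_quadratic (c := l2norm c * (l * l2norm (y - x) ^+ 2))
  (jacobian_line c cD dh Dx Dy).
rewrite scale1r !scale0r addr0 subrKC -!dotBr -/c => H.
have {}H : `|dot c c| <= l2norm c * (l * l2norm (y - x) ^+ 2) / 2.
  apply: H; first by rewrite !mulr_ge0 ?sqr_ge0 ?l2norm_ge0.
  move=> t t01; rewrite -dotBr -mulmxBl (le_trans (cauchy_schwarz_abs _ _)) //.
  rewrite -mulrA ler_wpM2l ?l2norm_ge0 // (le_trans (specnorm_mul _ _)) //.
  have := lJ _ _ (cD _ _ _ Dx Dy t01) Dx; rewrite addrAC subrr add0r l2normZ.
  case/andP: t01 => t0 _; rewrite ger0_norm //.
  have := l2norm_ge0 (y - x); set a := l2norm _; set b := specnorm _; nra.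
have := le_trans (ler_norm _) H; set a := l2norm c; set b := l2norm _; lra.
Qed.

(** For a convex D these vectors form the linear span of the differences of its
    points. *)
Definition tangent p (D : set 'cV[R]_p) (u : 'cV[R]_p) : Prop :=
  exists s y z, [/\ 0 <= s, D y, D z & u = s *: (y - z)].

Lemma jacobian_feas_bound p q (D : set 'cV[R]_p) (h : 'cV[R]_p -> 'cV[R]_q)
    (J : 'cV[R]_p -> 'M[R]_(q, p)) (L l : R) :
  segment_closed D -> (forall z, D z -> is_jacobian D h z (J z)) -> 0 <= l ->
  (forall x y, D x -> D y -> specnorm (J x - J y) <= l * l2norm (x - y)) ->
  (forall x y, D x -> D y -> l2norm (h x - h y) <= L * l2norm (x - y)) ->
  forall x y, D x -> D y -> l2norm (J x *m (y - x)) <= L * l2norm (y - x).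
Proof.
move=> cD dh l0 lJ Lh x y Dx Dy; set u := y - x.
apply: (@le_of_small _ _ _ (l / 2 * l2norm u ^+ 2)) => t t0 t1.
have Dt : D (x + t *: u) by apply: cD => //; rewrite (ltW t0).
have xu : x + t *: u - x = t *: u by rewrite addrAC subrr add0r.
have H1 := jacobian_quadratic cD dh l0 lJ Dx Dt.
have H2 := Lh _ _ Dt Dx.
have H3 := ler_l2normB (h (x + t *: u) - h x)
  (h (x + t *: u) - h x - J x *m (x + t *: u - x)).
move: H1 H2 H3; rewrite subKr xu -scalemxAr !l2normZ (gtr0_norm t0).
set a := l2norm _; set b := l2norm _; set c := l2norm _ => H1 H2 H3.
rewrite -(ler_pM2l t0); nra.
Qed.

(** For a convex set, every direction in the linear span of its differences is
    feasible at some point arbitrarily close to x; continuity of the Jacobian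
    carries the bound there back to x. This covers sets with empty interior. *)
Lemma jacobian_tangent_bound p q (D : set 'cV[R]_p) (h : 'cV[R]_p -> 'cV[R]_q)
    (J : 'cV[R]_p -> 'M[R]_(q, p)) (L l : R) :
  segment_closed D -> (forall z, D z -> is_jacobian D h z (J z)) -> 0 <= l ->
  (forall x y, D x -> D y -> specnorm (J x - J y) <= l * l2norm (x - y)) ->
  (forall x y, D x -> D y -> l2norm (h x - h y) <= L * l2norm (x - y)) ->
  forall x u, D x -> tangent D u -> l2norm (J x *m u) <= L * l2norm u.
Proof.
move=> cD dh l0 lJ Lh x _ Dx [s [y [z [s0 Dy Dz ->]]]].
rewrite -scalemxAr !l2normZ mulrCA ler_wpM2l // {s s0}; set u := y - z.
apply: (@le_of_small _ _ _ (l * l2norm (z - x) * l2norm u)) => t t0 t1.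
have t01 : 0 <= t <= 1 by rewrite (ltW t0).
pose w := x + t *: (z - x); have Dw : D w by exact: cD.
have Dw' : D (x + t *: (y - x)) by exact: cD.
have H1 := jacobian_feas_bound cD dh l0 lJ Lh Dw Dw'.
have wt : x + t *: (y - x) - w = t *: u.
  by rewrite /w /u opprD addrACA subrr add0r -scalerBr opprB addrA subrK.
move: H1; rewrite wt -scalemxAr !l2normZ (gtr0_norm t0) mulrCA ler_pM2l // => H1.
have H2 : l2norm ((J x - J w) *m u) <= t * (l * l2norm (z - x) * l2norm u).
  rewrite (le_trans (specnorm_mul _ _)) // !mulrA ler_wpM2r ?l2norm_ge0 //.
  rewrite (le_trans (lJ _ _ Dx Dw)) // l2normBC /w addrAC subrr add0r l2normZ.
  by rewrite (gtr0_norm t0) mulrCA mulrA.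
have := ler_l2normD (J w *m u) ((J x - J w) *m u).
rewrite -mulmxDl addrC subrK => H3; lra.
Qed.

End Smoothness.

(** * Projection onto the directions of a convex set *)

Section Projection.
Context {R : realType} {p : nat}.
Implicit Types (V : 'cV[R]_p -> Prop) (D : set 'cV[R]_p) (Q : 'M[R]_p).

Lemma tangentZ D (c : R) u : tangent D u -> tangent D (c *: u).
Proof.
move=> [s [y [z [s0 Dy Dz ->]]]]; have [c0|/ltW c0] := leP 0 c.
  by exists (c * s), y, z; rewrite mulr_ge0 // scalerA.
exists (- c * s), z, y; rewrite mulr_ge0 ?oppr_ge0 // scalerA; split=> //.
by rewrite mulNr scaleNr -scalerN opprB.
Qed.

Lemma tangentD D u v : segment_closed D ->
  tangent D u -> tangent D v -> tangent D (u + v).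
Proof.
move=> cD [s [y [z [s0 Dy Dz ->]]]] [t [y' [z' [t0 Dy' Dz' ->]]]].
have [st|st] := eqVneq (s + t) 0.
  have [-> ->] : s = 0 /\ t = 0 by split; lra.
  by rewrite !scale0r addr0; exists 0, y, z; rewrite scale0r.
have st0 : 0 < s + t by rewrite lt0r st addr_ge0.
have w01 : 0 <= t / (s + t) <= 1.
  by rewrite divr_ge0 ?addr_ge0 //= ler_pdivrMr // mul1r lerDr.
exists (s + t), (y + (t / (s + t)) *: (y' - y)), (z + (t / (s + t)) *: (z' - z)).
split; [exact: addr_ge0 | exact: cD | exact: cD |].
by apply/colP => i; rewrite !mxE; field.
Qed.

Lemma tangentB D x y : D x -> D y -> tangent D (x - y).
Proof. by move=> Dx Dy; exists 1, x, y; rewrite scale1r. Qed.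

Definition is_proj V Q :=
  [/\ forall u, V (Q *m u), Q^T = Q & Q *m Q = Q].

Lemma trace_sym_idem_ge0 Q : Q^T = Q -> Q *m Q = Q -> 0 <= \tr Q.
Proof.
move=> QT QQ; rewrite -QQ -{1}QT; apply: sumr_ge0 => i _; rewrite mxE.
by apply: sumr_ge0 => j _; rewrite mxE -expr2 sqr_ge0.
Qed.

(** The trace of an orthogonal projection is its rank: a projection into V of
    maximal trace must fix V, since otherwise the direction w of V that it
    misses could be adjoined to its range. *)
Lemma exists_proj V :
  V 0 -> (forall u v, V u -> V v -> V (u + v)) -> (forall c u, V u -> V (c *: u)) ->
  exists Q, is_proj V Q /\ forall u, V u -> Q *m u = u.
Proof.
move=> V0 VD VZ.
pose P n := `[< exists Q, is_proj V Q /\ \tr Q = n%:R >].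
have exP : exists n, P n.
  exists 0; apply/asboolP; exists 0; split; last by rewrite mxtrace0.
  by split=> [u||]; rewrite ?mul0mx ?trmx0.
have boundP n : P n -> (n <= p)%N.
  move=> /asboolP[Q [[_ QT QQ] trQ]].
  have : 0 <= \tr (1%:M - Q).
    apply: trace_sym_idem_ge0; first by rewrite linearB /= trmx1 QT.
    by rewrite mulmxBl mul1mx mulmxBr mulmx1 QQ subrr subr0.
  by rewrite linearB /= mxtrace1 trQ subr_ge0 ler_nat.
case: (ex_maxnP exP boundP) => n /asboolP[Q [[VQ QT QQ] trQ]] maxn.
exists Q; split=> // v Vv; apply/eqP/negP => /negP vQ.
pose w := v - Q *m v.
have w0 : w != 0 by rewrite subr_eq0 eq_sym.
have Vw : V w by rewrite /w -scaleN1r; apply: VD => //; exact: VZ.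
have Qw : Q *m w = 0 by rewrite mulmxBr mulmxA QQ subrr.
have wQ : w^T *m Q = 0 by rewrite -QT -trmx_mul Qw trmx0.
have dw : dot w w != 0 by apply: contraNneq w0 => /dot_eq0 ->.
have ww : w^T *m w = (dot w w)%:M.
  rewrite [LHS]mx11_scalar; congr (_%:M); rewrite mxE.
  by apply: eq_bigr => i _; rewrite mxE.
pose Q' := Q + (dot w w)^-1 *: (w *m w^T).
suff /maxn : P n.+1 by rewrite ltnn.
apply/asboolP; exists Q'; split; last first.
  rewrite linearD linearZ /= mxtrace_mulC ww mxtrace_scalar mulr1n mulVf // trQ.
  by rewrite natr1.
split.
- move=> u; rewrite mulmxDl; apply: VD => //; rewrite -scalemxAl; apply: (VZ).
  rewrite -mulmxA [w^T *m u]mx11_scalar mul_mx_scalar; exact: VZ.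
- by rewrite linearD linearZ /= QT trmx_mul trmxK.
- rewrite mulmxDl !mulmxDr QQ -!scalemxAl -!scalemxAr.
  rewrite [Q *m (w *m _)]mulmxA Qw mul0mx scaler0 addr0.
  rewrite -[w *m w^T *m Q]mulmxA wQ mulmx0 scaler0 add0r.
  rewrite -[w *m w^T *m _]mulmxA [w^T *m (w *m _)]mulmxA ww mul_scalar_mx.
  by rewrite -scalemxAr scalerA mulVf // scale1r.
Qed.

Lemma proj_dot V Q : is_proj V Q -> (forall u, V u -> Q *m u = u) ->
  forall u v, V v -> dot (Q *m u) v = dot u v.
Proof. by move=> [_ QT _] QV u v Vv; rewrite -[Q in LHS]QT dot_trmx QV. Qed.

(** Projected adjoints see only the action of the matrix on V. *)
Lemma proj_adjoint_bound V Q k (A : 'M[R]_(k, p)) (c : R) : is_proj V Q ->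
  0 <= c -> (forall u, V u -> l2norm (A *m u) <= c * l2norm u) ->
  forall v, l2norm (Q *m (A^T *m v)) <= c * l2norm v.
Proof.
move=> [VQ QT QQ] c0 Ac v; apply: dot_l2norm_le.
  by rewrite mulr_ge0 ?l2norm_ge0.
rewrite -{1}QT dot_trmx mulmxA QQ dot_trmx.
apply: (le_trans (cauchy_schwarz _ _)).
by rewrite mulrAC mulrC ler_wpM2r ?l2norm_ge0 //; apply: Ac; exact: VQ.
Qed.

End Projection.

(** * The objective and the proximal step *)

Section MeanMap.
Context {R : realType}.

Lemma l2norm_vmean (D : finType) p (Y : D -> 'cV[R]_p) (c : R) :
  (0 < #|D|)%N -> (forall j, l2norm (Y j) <= c) -> l2norm (vmean Y) <= c.
Proof.
move=> D0 Yc; have c0 : 0 <= c.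
  by case/card_gt0P: D0 => j _; rewrite (le_trans (l2norm_ge0 _) (Yc j)).
rewrite l2normZ ger0_norm ?invr_ge0 // mulrC ler_pdivrMr ?ltr0n //.
rewrite (le_trans (ler_l2norm_sum _ _)) // (le_trans (ler_sum _ (fun j _ => Yc j))) //.
by rewrite sumr_const mulr_natr.
Qed.

Lemma l2norm_smean (D : Type) n p (Y : D -> 'cV[R]_p) (A : n.-tuple D) (c : R) :
  0 <= c -> (forall j, l2norm (Y j) <= c) -> l2norm (smean Y A) <= c.
Proof.
move=> c0 Yc; case: n A => [|n] A.
  by rewrite /smean invr0 scale0r l2norm0.
rewrite l2normZ ger0_norm ?invr_ge0 // mulrC ler_pdivrMr ?ltr0n //.
rewrite (le_trans (ler_l2norm_sum _ _)) // big_tuple.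
rewrite (le_trans (ler_sum _ (fun j _ => Yc _))) //.
by rewrite sumr_const card_ord mulr_natr.
Qed.

Lemma vmeanB (V : lmodType R) (D : finType) (Y Z : D -> V) :
  vmean (fun j => Y j - Z j) = vmean Y - vmean Z.
Proof. by rewrite /vmean sumrB scalerBr. Qed.

Lemma mulmx_vmeanl (D : finType) p q (A : D -> 'M[R]_(p, q)) (u : 'cV[R]_q) :
  vmean A *m u = vmean (fun j => A j *m u).
Proof. by rewrite /vmean -scalemxAl mulmx_suml. Qed.

Lemma mulmx_vmeanr (D : finType) p q (A : 'M[R]_(p, q)) (Y : D -> 'cV[R]_q) :
  A *m vmean Y = vmean (fun j => A *m Y j).
Proof. by rewrite /vmean -scalemxAr mulmx_sumr. Qed.

Lemma mulmx_smeanl (D : Type) n p q (A : D -> 'M[R]_(p, q)) (s : n.-tuple D)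
    (u : 'cV[R]_q) :
  smean A s *m u = smean (fun j => A j *m u) s.
Proof. by rewrite /smean -scalemxAl mulmx_suml. Qed.

Lemma mulmx_smeanr (D : Type) n p q (A : 'M[R]_(p, q)) (Y : D -> 'cV[R]_q)
    (s : n.-tuple D) :
  A *m smean Y s = smean (fun j => A *m Y j) s.
Proof. by rewrite /smean -scalemxAr mulmx_sumr. Qed.

Lemma trmx_vmean (D : finType) p q (A : D -> 'M[R]_(p, q)) :
  (vmean A)^T = vmean (fun j => (A j)^T).
Proof. by rewrite /vmean linearZ /= linear_sum. Qed.

Lemma trmx_smean (D : Type) n p q (A : D -> 'M[R]_(p, q)) (s : n.-tuple D) :
  (smean A s)^T = smean (fun j => (A j)^T) s.
Proof. by rewrite /smean linearZ /= linear_sum. Qed.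

End MeanMap.

Section Objective.
Context {R : realType} {d k m n : nat} (pb : problem R d k m n).
Context (Lf lf Lg lg : R) (Hpb : assumptions pb Lf lf Lg lg).
Context (m0 : (0 < m)%N) (n0 : (0 < n)%N).
Implicit Types (x y u : 'cV[R]_d).

Let X := feas pb.
Let Lf0 : 0 <= Lf := Lf_ge0 Hpb.
Let lf0 : 0 <= lf := lf_ge0 Hpb.
Let Lg0 : 0 <= Lg := Lg_ge0 Hpb.
Let lg0 : 0 <= lg := lg_ge0 Hpb.
Let cX : segment_closed X := convex_segment (feas_convex Hpb).
Let m1 : (0 < #|'I_m|)%N. Proof. by rewrite card_ord. Qed.
Let n1 : (0 < #|'I_n|)%N. Proof. by rewrite card_ord. Qed.

Definition inner_mean x : 'cV[R]_k := vmean (fun j => inner pb j x).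
Definition jac_mean x : 'M[R]_(k, d) := vmean (fun j => jac pb j x).
Definition outer_grad (y : 'cV[R]_k) : 'cV[R]_k := vmean (fun i => grad (outer pb i) y).
Definition smooth_grad x : 'cV[R]_d := (jac_mean x)^T *m outer_grad (inner_mean x).

Let ell := Lf * lg + Lg ^+ 2 * lf.

Lemma ell_ge0 : 0 <= ell.
Proof. by rewrite addr_ge0 ?mulr_ge0 // sqr_ge0. Qed.

Lemma smooth_partE x : smooth_part pb x = avg (fun i => outer pb i (inner_mean x)).
Proof. by rewrite /smooth_part /avg /inner_mean /vmean !card_ord. Qed.

Lemma inner_mean_lipschitz x y : X x -> X y ->
  l2norm (inner_mean x - inner_mean y) <= Lg * l2norm (x - y).
Proof.
move=> Xx Xy; rewrite -vmeanB; apply: l2norm_vmean => // j.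
exact: (inner_lipschitz Hpb).
Qed.

Lemma jac_mul_lipschitz j x y u : X x -> X y ->
  l2norm ((jac pb j x - jac pb j y) *m u) <= lg * l2norm (x - y) * l2norm u.
Proof.
move=> Xx Xy; rewrite (le_trans (specnorm_mul _ _)) // ler_wpM2r ?l2norm_ge0 //.
exact: (inner_jacobian_lipschitz Hpb).
Qed.

Lemma jac_tangent j x u : X x -> tangent X u ->
  l2norm (jac pb j x *m u) <= Lg * l2norm u.
Proof.
exact: (jacobian_tangent_bound cX (fun z => @inner_jacobian _ _ _ _ _ _ _ _ _ _ Hpb j z) lg0
  (inner_jacobian_lipschitz Hpb j) (inner_lipschitz Hpb j)).
Qed.

Lemma jac_mean_tangent x u : X x -> tangent X u ->
  l2norm (jac_mean x *m u) <= Lg * l2norm u.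
Proof.
move=> Xx Vu; rewrite mulmx_vmeanl; apply: l2norm_vmean => // j.
exact: jac_tangent.
Qed.

Lemma outer_grad_bound i (y : 'cV[R]_k) : l2norm (grad (outer pb i) y) <= Lf.
Proof.
exact: (grad_bound (outer_differentiable Hpb i) Lf0 lf0
  (outer_lipschitz Hpb i) (outer_grad_lipschitz Hpb i)).
Qed.

Lemma outer_grad_mean_bound (y : 'cV[R]_k) : l2norm (outer_grad y) <= Lf.
Proof. by apply: l2norm_vmean => // i; exact: outer_grad_bound. Qed.

Lemma outer_grad_mean_lipschitz (y z : 'cV[R]_k) :
  l2norm (outer_grad y - outer_grad z) <= lf * l2norm (y - z).
Proof.
by rewrite -vmeanB; apply: l2norm_vmean => // i; exact: (outer_grad_lipschitz Hpb).
Qed.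

(** Expanding f at the inner value and g at x separately gives the smoothness
    constant of the composition without differentiating it. *)
Lemma smooth_part_quadratic x y : X x -> X y ->
  `|smooth_part pb y - smooth_part pb x - dot (smooth_grad x) (y - x)| <=
  ell / 2 * l2norm (y - x) ^+ 2.
Proof.
move=> Xx Xy; set gx := inner_mean x; set gy := inner_mean y.
set D := l2norm (y - x); have D0 : 0 <= D by exact: l2norm_ge0.
have innerq : l2norm (gy - gx - jac_mean x *m (y - x)) <= lg / 2 * D ^+ 2.
  rewrite mulmx_vmeanl -!vmeanB; apply: l2norm_vmean => // j.
  exact: (jacobian_quadratic cX (fun z => @inner_jacobian _ _ _ _ _ _ _ _ _ _ Hpb j z) lg0
    (inner_jacobian_lipschitz Hpb j)).
have gxy : l2norm (gy - gx) <= Lg * D by exact: inner_mean_lipschitz.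
pose q i := outer pb i gy - outer pb i gx - dot (grad (outer pb i) gx) (gy - gx).
have qb i : `|q i| <= lf / 2 * (Lg * D) ^+ 2.
  apply: (le_trans (grad_quadratic (outer_differentiable Hpb i) lf0
    (outer_grad_lipschitz Hpb i) _ _)).
  by rewrite ler_wpM2l ?divr_ge0 // lerXn2r ?nnegrE ?l2norm_ge0 ?mulr_ge0.
have -> : smooth_part pb y - smooth_part pb x - dot (smooth_grad x) (y - x) =
    avg q + dot (outer_grad gx) (gy - gx - jac_mean x *m (y - x)).
  rewrite !smooth_partE dot_trmx dotBr -/gx -/gy /q !avgD !avgN.
  have -> : dot (outer_grad gx) (gy - gx) =
      avg (fun i => dot (grad (outer pb i) gx) (gy - gx)).
    by rewrite dotC dot_vmean; apply: eq_avg => i; rewrite dotC.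
  by ring.
apply: (le_trans (ler_normD _ _)).
have H1 : `|avg q| <= lf / 2 * (Lg * D) ^+ 2.
  apply/ler_normlP; split; rewrite -?avgN; apply: avg_le_cst => // i.
    by case/ler_normlP: (qb i).
  by case/ler_normlP: (qb i).
have H2 := cauchy_schwarz_abs (outer_grad gx) (gy - gx - jac_mean x *m (y - x)).
have H3 := ler_pM (l2norm_ge0 _) (l2norm_ge0 _) (outer_grad_mean_bound gx) innerq.
move: (le_trans H2 H3) H1; rewrite /ell; set a := `| _ |; set b := `| _ |; nra.
Qed.

Lemma smooth_part_segment x y t : X x -> X y -> 0 <= t <= 1 ->
  smooth_part pb (x + t *: (y - x)) <=
  smooth_part pb x + t * (smooth_part pb y - smooth_part pb x).
Proof.
move=> Xx Xy /andP[t0 t1].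
have := smooth_part_convex Hpb (Itv01 t0 t1) (mem_set Xy) (mem_set Xx).
rewrite [X in _ -> _ <= X](_ : _ =
  t * smooth_part pb y + (1 - t) * smooth_part pb x); last by ring.
congr (_ <= _); congr smooth_part.
have -> : x + t *: (y - x) = t *: y + (1 - t) *: x; last by [].
by apply/colP => i; rewrite !mxE; ring.
Qed.

Lemma smooth_part_convexity x y : X x -> X y ->
  smooth_part pb x + dot (smooth_grad x) (y - x) <= smooth_part pb y.
Proof.
move=> Xx Xy; apply: (@le_of_small _ _ _ (ell / 2 * l2norm (y - x) ^+ 2)) => t t0 t1.
have t01 : 0 <= t <= 1 by rewrite (ltW t0).
have := smooth_part_quadratic Xx (cX Xx Xy t01).
have -> : x + t *: (y - x) - x = t *: (y - x) by rewrite addrAC subrr add0r.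
rewrite dotZr l2normZ (gtr0_norm t0) => /ler_normlP[H1 _].
have H2 := smooth_part_segment Xx Xy t01.
rewrite -(ler_pM2l t0); nra.
Qed.

(** Real value of the regularizer, meaningful where it is finite. *)
Definition regr x : R := fine (reg pb x).
Definition objr x : R := smooth_part pb x + regr x.

Lemma reg_finP x : (reg pb x < +oo)%E -> reg pb x = (regr x)%:E.
Proof.
move=> rx; rewrite /regr fineK // fin_numElt rx andbT.
exact: (reg_ninfty Hpb).
Qed.

Lemma objectiveE x : (reg pb x < +oo)%E -> objective pb x = (objr x)%:E.
Proof. by move=> /reg_finP rx; rewrite /objective rx. Qed.

Lemma regr_convex x y t : (reg pb x < +oo)%E -> (reg pb y < +oo)%E -> 0 <= t <= 1 ->
  (reg pb (x + t *: (y - x)) < +oo)%E /\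
  regr (x + t *: (y - x)) <= regr x + t * (regr y - regr x).
Proof.
move=> rx ry t01.
have := reg_convex Hpb (x := y) (y := x) (t := t) I I t01.
rewrite (reg_finP rx) (reg_finP ry) -!EFinM -EFinD.
have -> : t *: y + (1 - t) *: x = x + t *: (y - x).
  by apply/colP => i; rewrite !mxE; ring.
move=> H; have fin : (reg pb (x + t *: (y - x)) < +oo)%E.
  by rewrite (le_lt_trans H) // ltry.
split=> //; move: H; rewrite (reg_finP fin) lee_fin; lra.
Qed.

Lemma prox_feas eta z : 0 < eta -> X (prox pb eta z).
Proof. by move=> eta0; have [] := prox_argmin Hpb z eta0. Qed.

Lemma prox_fin eta z y : 0 < eta -> X y -> (reg pb y < +oo)%E ->
  (reg pb (prox pb eta z) < +oo)%E.
Proof.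
move=> eta0 Xy ry; have [_ /(_ y Xy)] := prox_argmin Hpb z eta0.
rewrite (reg_finP ry) -EFinD.
have := reg_ninfty Hpb (prox pb eta z).
by case: (reg pb _) => // r _ _; rewrite ltry.
Qed.

(** The prox objective is strongly convex, hence grows quadratically away from
    its minimizer. *)
Lemma prox_three_point eta z y : 0 < eta -> X y -> (reg pb y < +oo)%E ->
  forall w x', w = (2 * eta)^-1 -> x' = prox pb eta z ->
  regr x' + w * l2norm (x' - z) ^+ 2 + w * l2norm (y - x') ^+ 2 <=
  regr y + w * l2norm (y - z) ^+ 2.
Proof.
move=> eta0 Xy ry w x' wE x'E.
have rx' := prox_fin z eta0 Xy ry; have Xx' := prox_feas z eta0.
rewrite -x'E in rx' Xx'.
apply: (@le_of_small _ _ _ (w * l2norm (y - x') ^+ 2)) => t t0 t1.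
have t01 : 0 <= t <= 1 by rewrite (ltW t0).
have [rt Ht] := regr_convex rx' ry t01.
have [_ /(_ _ (cX Xx' Xy t01))] := prox_argmin Hpb z eta0.
rewrite -x'E -wE (reg_finP rx') (reg_finP rt) -!EFinD lee_fin.
have -> : x' + t *: (y - x') - z = (x' - z) + t *: (y - x') by rewrite addrAC.
have -> : y - z = (x' - z) + (y - x') by rewrite [RHS]addrC subrKA.
move: (x' - z) (y - x') Ht => u v Ht.
rewrite !l2norm_sqrD dotZr l2normZ (gtr0_norm t0) => H.
rewrite -(ler_pM2l t0); nra.
Qed.

(** One proximal step along an arbitrary v: the progress is that of exact
    proximal gradient, up to the error of v as a gradient estimate. *)
Lemma prox_step_descent eta x v y : 0 < eta -> X x -> X y -> (reg pb y < +oo)%E ->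
  forall w x', w = (2 * eta)^-1 -> x' = prox pb eta (x - eta *: v) ->
  objr x' - objr y + w * l2norm (x' - y) ^+ 2 <=
  w * l2norm (x - y) ^+ 2 + dot (smooth_grad x - v) (x' - y) +
  (ell / 2 - w) * l2norm (x' - x) ^+ 2.
Proof.
move=> eta0 Xx Xy ry w x' wE x'E.
have Xx' : X x' by rewrite x'E; exact: prox_feas.
have := prox_three_point eta0 Xy ry wE x'E; rewrite !opprB.
have -> : x' + (eta *: v - x) = (x' - x) + eta *: v by rewrite addrAC addrA.
have -> : y + (eta *: v - x) = (y - x) + eta *: v by rewrite addrAC addrA.
rewrite (l2norm_sqrD (x' - x)) (l2norm_sqrD (y - x)) !dotZr => H1.
have w2 : w * (2 * eta) = 1 by rewrite wE mulVf // mulf_neq0 // gt_eqF.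
have /ler_normlP[_ H2] := smooth_part_quadratic Xx Xx'.
have H3 := smooth_part_convexity Xx Xy.
have {}H1 : regr x' + w * l2norm (x' - x) ^+ 2 + dot (x' - x) v +
    w * l2norm (y - x') ^+ 2 <= regr y + w * l2norm (y - x) ^+ 2 + dot (y - x) v.
  move: H1.
  rewrite [X in _ <= X -> _](_ : _ = regr y + w * l2norm (y - x) ^+ 2 +
    w * (2 * eta) * dot (y - x) v + w * l2norm (eta *: v) ^+ 2); last by ring.
  rewrite [X in X <= _ -> _](_ : _ = regr x' + w * l2norm (x' - x) ^+ 2 +
    w * (2 * eta) * dot (x' - x) v + w * l2norm (eta *: v) ^+ 2 +
    w * l2norm (y - x') ^+ 2); last by ring.
  rewrite w2 !mul1r; lra.
rewrite (l2normBC x' y) (l2normBC x y) dotBl /objr.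
have -> : dot (smooth_grad x) (x' - y) =
    dot (smooth_grad x) (x' - x) - dot (smooth_grad x) (y - x).
  by rewrite -dotBr opprB addrA subrK.
have -> : dot v (x' - y) = dot (x' - x) v - dot (y - x) v.
  by rewrite !(dotC _ v) -dotBr opprB addrA subrK.
move: H1 H2 H3; set a := l2norm _; set b := l2norm _; set c := l2norm _.
lra.
Qed.

(** The error is paired with the difference of two feasible points in x' - x, so only
    its projection counts there; Young's inequality absorbs |x' - x|^2 into the
    negative quadratic term. *)
Lemma prox_step_descent_proj Q eta x v y :
  is_proj (tangent X) Q -> (forall u, tangent X u -> Q *m u = u) ->
  0 < eta -> X x -> X y -> (reg pb y < +oo)%E ->
  forall w x', w = (2 * eta)^-1 -> x' = prox pb eta (x - eta *: v) ->
  ell / 2 < w ->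
  objr x' - objr y + w * l2norm (x' - y) ^+ 2 <=
  w * l2norm (x - y) ^+ 2 + dot (smooth_grad x - v) (x - y) +
  l2norm (Q *m (smooth_grad x - v)) ^+ 2 / (4 * (w - ell / 2)).
Proof.
move=> VQ QV eta0 Xx Xy ry w x' wE x'E lw.
apply: (le_trans (prox_step_descent eta0 Xx Xy ry wE x'E)).
have Xx' : X x' by rewrite x'E; exact: prox_feas.
set e := smooth_grad x - v.
have -> : dot e (x' - y) = dot e (x - y) + dot (Q *m e) (x' - x).
  rewrite (proj_dot VQ QV); last exact: tangentB.
  by rewrite -dotDr; congr dot; rewrite [RHS]addrC subrKA.
have c0 : 0 < w - ell / 2 by rewrite subr_gt0.
have := cauchy_schwarz (Q *m e) (x' - x).
set a := l2norm (Q *m e); set b := l2norm (x' - x); set c := w - ell / 2 in c0 *.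
have -> : ell / 2 - w = - c by rewrite opprB.
move=> H; have : 0 <= (a / (2 * c) - b) ^+ 2 * c.
  by rewrite mulr_ge0 ?sqr_ge0 // ltW.
have -> : (a / (2 * c) - b) ^+ 2 * c = a ^+ 2 / (4 * c) - a * b + c * b ^+ 2.
  by field; rewrite gt_eqF.
lra.
Qed.

End Objective.

(** * The variance-reduced gradient estimate *)

Section Estimator.
Context {R : realType} {d k m n a b : nat} (pb : problem R d k m n).
Context (Lf lf Lg lg : R) (Hpb : assumptions pb Lf lf Lg lg).
Context (m0 : (0 < m)%N) (n0 : (0 < n)%N) (a0 : (0 < a)%N) (b0 : (0 < b)%N).
Implicit Types (x y u : 'cV[R]_d) (A : a.-tuple 'I_m) (B : b.-tuple 'I_n).

Let X := feas pb.
Let Lf0 : 0 <= Lf := Lf_ge0 Hpb.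
Let lf0 : 0 <= lf := lf_ge0 Hpb.
Let Lg0 : 0 <= Lg := Lg_ge0 Hpb.
Let lg0 : 0 <= lg := lg_ge0 Hpb.
Let m1 : (0 < #|'I_m|)%N. Proof. by rewrite card_ord. Qed.
Let n1 : (0 < #|'I_n|)%N. Proof. by rewrite card_ord. Qed.
Let A1 : (0 < #|{: a.-tuple 'I_m}|)%N.
Proof. by rewrite card_tuple expn_gt0 m1. Qed.
Let B1 : (0 < #|{: b.-tuple 'I_n}|)%N.
Proof. by rewrite card_tuple expn_gt0 n1. Qed.
Let ell := Lf * lg + Lg ^+ 2 * lf.

Definition inner_est xref x A : 'cV[R]_k :=
  inner_mean pb xref + smean (fun j => inner pb j x - inner pb j xref) A.

Definition jac_est xref x A : 'M[R]_(k, d) :=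
  jac_mean pb xref + smean (fun j => jac pb j x - jac pb j xref) A.

Definition grad_est xref x A B : 'cV[R]_d :=
  smooth_grad pb xref + smean (fun i =>
    (jac_est xref x A)^T *m grad (outer pb i) (inner_est xref x A) -
    (jac_mean pb xref)^T *m grad (outer pb i) (inner_mean pb xref)) B.

Section Bounds.
Context (xref x : 'cV[R]_d) (Xr : X xref) (Xx : X x).

Let rho := l2norm (x - xref).
Let rho0 : 0 <= rho. Proof. exact: l2norm_ge0. Qed.

Lemma inner_est_var :
  avg (fun A => l2norm (inner_est xref x A - inner_mean pb x) ^+ 2) <=
  (Lg * rho) ^+ 2 / a%:R.
Proof.
have H := smean_variance m1 a0
  (fun j => inner_lipschitz Hpb j Xx Xr).
apply: le_trans H; rewrite le_eqVlt; apply/orP; left; apply/eqP.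
apply: eq_avg => A; rewrite vmeanB /inner_est opprB addrA; congr (l2norm _ ^+ 2).
by rewrite -!/(inner_mean _ _) addrAC addrC addrA.
Qed.

Lemma inner_est_ref A : l2norm (inner_est xref x A - inner_mean pb xref) <= Lg * rho.
Proof.
rewrite /inner_est addrAC subrr add0r; apply: l2norm_smean.
  by rewrite mulr_ge0.
by move=> j; exact: (inner_lipschitz Hpb).
Qed.

Lemma jac_est_var u :
  avg (fun A => l2norm ((jac_est xref x A - jac_mean pb x) *m u) ^+ 2) <=
  (lg * rho * l2norm u) ^+ 2 / a%:R.
Proof.
have H := smean_variance m1 a0
  (fun j => jac_mul_lipschitz Hpb j u Xx Xr).
apply: le_trans H; rewrite le_eqVlt; apply/orP; left; apply/eqP.
apply: eq_avg => A; rewrite -mulmx_smeanl -mulmx_vmeanl -mulmxBl vmeanB.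
rewrite -!/(jac_mean _ _) /jac_est; congr (l2norm (_ *m u) ^+ 2).
by rewrite opprB addrA addrAC addrC addrA.
Qed.

Lemma jac_est_trvar (c : 'cV[R]_k) :
  avg (fun A => l2norm ((jac_est xref x A - jac_mean pb x)^T *m c) ^+ 2) <=
  (lg * rho * l2norm c) ^+ 2 / a%:R.
Proof.
have H := smean_variance (Y := fun j => (jac pb j x - jac pb j xref)^T *m c) m1 a0.
apply: le_trans (H (lg * rho * l2norm c) _); last first.
  move=> j; apply: opbound_trmx; first by rewrite mulr_ge0.
  by move=> u; exact: (jac_mul_lipschitz Hpb j u Xx Xr).
rewrite le_eqVlt; apply/orP; left; apply/eqP.
apply: eq_avg => A; rewrite -mulmx_smeanl -mulmx_vmeanl -mulmxBl.
rewrite -trmx_smean -trmx_vmean -linearB /= vmeanB.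
rewrite -!/(jac_mean _ _) /jac_est; congr (l2norm (_^T *m c) ^+ 2).
by rewrite opprB addrA addrAC addrC addrA.
Qed.

Lemma jac_est_ref A u :
  l2norm ((jac_est xref x A - jac_mean pb xref) *m u) <= lg * rho * l2norm u.
Proof.
rewrite /jac_est addrAC subrr add0r mulmx_smeanl; apply: l2norm_smean.
  by rewrite !mulr_ge0 // l2norm_ge0.
by move=> j; exact: (jac_mul_lipschitz Hpb).
Qed.

Lemma jac_est_tangent A u : tangent X u ->
  l2norm (jac_est xref x A *m u) <= 3 * Lg * l2norm u.
Proof.
move=> Vu; have L0 : 0 <= Lg * l2norm u by rewrite mulr_ge0 ?l2norm_ge0.
rewrite mulmxDl (le_trans (ler_l2normD _ _)) //.
have H1 := jac_mean_tangent Hpb m0 Xr Vu.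
have H2 : l2norm (smean (fun j => jac pb j x - jac pb j xref) A *m u) <=
    2 * (Lg * l2norm u).
  rewrite mulmx_smeanl; apply: l2norm_smean => [|j]; first by rewrite mulr_ge0.
  rewrite mulmxBl (le_trans (ler_l2normB _ _)) //.
  have := jac_tangent Hpb j Xx Vu; have := jac_tangent Hpb j Xr Vu; lra.
lra.
Qed.

Lemma sqrt_div_sqr (c : R) : (c / Num.sqrt a%:R) ^+ 2 = c ^+ 2 / a%:R.
Proof. by rewrite expr_div_n sqr_sqrtr // ler0n. Qed.

(** The estimate is biased because f is nonlinear. Testing it against a fixed
    direction u replaces the Jacobian noise, a random matrix, by a random vector,
    whose variance obeys the sampling bound without any dimension factor. *)
Lemma grad_est_bias u : tangent X u ->
  avg (fun A => avg (fun B => dot (smooth_grad pb x - grad_est xref x A B) u)) <=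
  ell / Num.sqrt a%:R * rho * l2norm u.
Proof.
move=> Vu; set s := Num.sqrt a%:R.
have s0 : 0 < s by rewrite sqrtr_gt0 ltr0n.
have u0 := l2norm_ge0 u.
pose Z A := l2norm ((jac_est xref x A - jac_mean pb x) *m u).
pose G A := l2norm (inner_est xref x A - inner_mean pb x).
have HZ : avg Z <= lg * rho * l2norm u / s.
  apply: avg_le_of_sqr => //; first by rewrite divr_ge0 ?mulr_ge0 // ltW.
  by rewrite sqrt_div_sqr; exact: jac_est_var.
have HG : avg G <= Lg * rho / s.
  apply: avg_le_of_sqr => //; first by rewrite divr_ge0 ?mulr_ge0 // ltW.
  by rewrite sqrt_div_sqr; exact: inner_est_var.
apply: (@le_trans _ _ (avg (fun A => lf * (Lg * l2norm u) * G A + Lf * Z A))).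
  apply: ler_avg => A.
  under eq_avg => B do rewrite dotC /grad_est opprD addrA dotBr.
  rewrite avgD avg_cst // avgN avg_dot_smean // vmeanB -!mulmx_vmeanr.
  rewrite -!/(outer_grad _ _) -/(smooth_grad _ _) !dotBr opprB addrA subrK.
  set g := outer_grad pb _; set ga := inner_est xref x A in g *.
  have -> : dot u (smooth_grad pb x) - dot u ((jac_est xref x A)^T *m g) =
      dot (outer_grad pb (inner_mean pb x) - g) (jac_mean pb x *m u) -
      dot g ((jac_est xref x A - jac_mean pb x) *m u).
    rewrite !(dotC u) !dot_trmx mulmxBl dotBr dotBl; ring.
  have H1 := cauchy_schwarz (outer_grad pb (inner_mean pb x) - g) (jac_mean pb x *m u).
  have H2 := cauchy_schwarz (- g) ((jac_est xref x A - jac_mean pb x) *m u).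
  rewrite dotNl l2normN in H2.
  have H3 := outer_grad_mean_lipschitz Hpb n0 (inner_mean pb x) ga.
  rewrite (l2normBC _ ga) -/g -/(G A) in H3.
  have H4 := jac_mean_tangent Hpb m0 Xx Vu.
  have H5 := outer_grad_mean_bound Hpb n0 ga.
  have H6 := ler_pM (l2norm_ge0 _) (l2norm_ge0 _) H3 H4.
  have H7 : l2norm g * Z A <= Lf * Z A by rewrite ler_wpM2r ?l2norm_ge0.
  rewrite /Z in H7 *; lra.
rewrite avgD !avgZ.
have H1 : lf * (Lg * l2norm u) * avg G <= lf * (Lg * l2norm u) * (Lg * rho / s).
  by rewrite ler_wpM2l ?mulr_ge0.
have H2 : Lf * avg Z <= Lf * (lg * rho * l2norm u / s) by rewrite ler_wpM2l.
apply: (le_trans (lerD H1 H2)); rewrite le_eqVlt; apply/orP; left; apply/eqP.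
by rewrite /ell; ring.
Qed.

(** The step taken depends on the sample, so its interaction with the noise is
    controlled by the second moment instead; only the component of the noise
    along the tangent directions matters. *)
Lemma grad_est_sqr Q : is_proj (tangent X) Q ->
  avg (fun A => avg (fun B =>
    l2norm (Q *m (smooth_grad pb x - grad_est xref x A B)) ^+ 2)) <=
  ell ^+ 2 * rho ^+ 2 * (b%:R^-1 + 18 / a%:R).
Proof.
move=> VQ.
have Q1 v : l2norm (Q *m v) <= l2norm v.
  rewrite -[leRHS]mul1r -{1}[v]mul1mx -trmx1; apply: (proj_adjoint_bound VQ) => //.
  by move=> w _; rewrite mul1mx mul1r.
pose c A i := (jac_est xref x A)^T *m grad (outer pb i) (inner_est xref x A) -
    (jac_mean pb xref)^T *m grad (outer pb i) (inner_mean pb xref).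
have cb A i : l2norm (Q *m c A i) <= ell * rho.
  set w := grad (outer pb i) (inner_est xref x A).
  set w' := grad (outer pb i) (inner_mean pb xref).
  have -> : c A i = (jac_est xref x A - jac_mean pb xref)^T *m w +
      (jac_mean pb xref)^T *m (w - w').
    by rewrite linearB /= mulmxBl mulmxBr addrA subrK.
  rewrite mulmxDr (le_trans (ler_l2normD _ _)) //.
  have H1 : l2norm (Q *m ((jac_est xref x A - jac_mean pb xref)^T *m w)) <=
      lg * rho * l2norm w.
    apply: (proj_adjoint_bound VQ); first by rewrite mulr_ge0.
    by move=> u _; exact: jac_est_ref.
  have H2 : l2norm (Q *m ((jac_mean pb xref)^T *m (w - w'))) <= Lg * l2norm (w - w').
    by apply: (proj_adjoint_bound VQ) => // u; exact: (jac_mean_tangent Hpb m0 Xr).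
  have H3 : l2norm (w - w') <= lf * (Lg * rho).
    apply: (le_trans (outer_grad_lipschitz Hpb i _ _)).
    by rewrite ler_wpM2l // inner_est_ref.
  have H4 : lg * rho * l2norm w <= lg * rho * Lf.
    by rewrite ler_wpM2l ?mulr_ge0 //; exact: (outer_grad_bound Hpb).
  have H5 : Lg * l2norm (w - w') <= Lg * (lf * (Lg * rho)) by rewrite ler_wpM2l.
  rewrite /ell; lra.
set g := outer_grad pb (inner_mean pb x).
pose P A := l2norm ((jac_est xref x A - jac_mean pb x)^T *m g) ^+ 2.
pose G A := l2norm (inner_est xref x A - inner_mean pb x) ^+ 2.
apply: (@le_trans _ _ (avg (fun A => (2 * P A + 2 * (3 * Lg * lf) ^+ 2 * G A) +
    b%:R^-1 * (ell * rho) ^+ 2))).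
  apply: ler_avg => A.
  set e := Q *m (smooth_grad pb xref - smooth_grad pb x).
  have -> : avg (fun B => l2norm (Q *m (smooth_grad pb x - grad_est xref x A B)) ^+ 2) =
      avg (fun B => l2norm (e + smean (fun i => Q *m c A i) B) ^+ 2).
    apply: eq_avg => B; rewrite -l2normN -mulmxN opprB -mulmx_smeanr -mulmxDr.
    by rewrite /grad_est addrAC.
  apply: (le_trans (smean_sqr n1 b0 _ _)); apply: lerD; last first.
    rewrite ler_wpM2l ?invr_ge0 //; apply: avg_le_cst => // i.
    by rewrite lerXn2r ?nnegrE ?l2norm_ge0 // (le_trans (l2norm_ge0 _) (cb A i)).
  set ga := outer_grad pb (inner_est xref x A).
  have -> : e + vmean (fun i => Q *m c A i) =
      Q *m ((jac_est xref x A - jac_mean pb x)^T *m g) +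
      Q *m ((jac_est xref x A)^T *m (ga - g)).
    rewrite -mulmx_vmeanr -!mulmxDr; congr (_ *m _).
    rewrite vmeanB -!mulmx_vmeanr -!/(outer_grad _ _) -/(smooth_grad _ _) -/ga.
    rewrite addrC addrA subrK linearB /= mulmxBl mulmxBr -/g.
    by rewrite [RHS]addrC addrA subrK.
  apply: (le_trans (l2norm_sqrD_le _ _)); apply: lerD.
    by rewrite ler_wpM2l // lerXn2r ?nnegrE ?l2norm_ge0.
  rewrite -[leRHS]mulrA ler_wpM2l // -exprMn lerXn2r ?nnegrE ?l2norm_ge0 ?mulr_ge0 ?l2norm_ge0 //.
  have L30 : 0 <= 3 * Lg by rewrite mulr_ge0.
  apply: (le_trans (proj_adjoint_bound VQ L30 (@jac_est_tangent A) _)).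
  rewrite -!mulrA !ler_wpM2l //; exact: (outer_grad_mean_lipschitz Hpb).
rewrite !avgD avg_cst // !avgZ.
have HP : avg P <= (lg * rho * Lf) ^+ 2 / a%:R.
  apply: (le_trans (jac_est_trvar g)); rewrite ler_wpM2r ?invr_ge0 //.
  rewrite lerXn2r ?nnegrE ?mulr_ge0 ?l2norm_ge0 // ler_wpM2l ?mulr_ge0 //.
  exact: (outer_grad_mean_bound Hpb).
have HG : avg G <= (Lg * rho) ^+ 2 / a%:R by exact: inner_est_var.
have H1 : 2 * (3 * Lg * lf) ^+ 2 * avg G <=
    2 * (3 * Lg * lf) ^+ 2 * ((Lg * rho) ^+ 2 / a%:R).
  by rewrite ler_wpM2l ?mulr_ge0 ?sqr_ge0.
have H2 : 2 * avg P <= 2 * ((lg * rho * Lf) ^+ 2 / a%:R) by rewrite ler_wpM2l.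
apply: (le_trans (lerD (lerD H2 H1) (lexx _))).
have -> : ell ^+ 2 * rho ^+ 2 * (b%:R^-1 + 18 / a%:R) =
  18 * (ell * rho) ^+ 2 / a%:R + b%:R^-1 * (ell * rho) ^+ 2 by ring.
rewrite lerD2r !mulrA -mulrDl ler_wpM2r ?invr_ge0 //.
have p0 : 0 <= Lf * lg by rewrite mulr_ge0.
have q0 : 0 <= Lg ^+ 2 * lf by rewrite mulr_ge0 // sqr_ge0.
rewrite /ell [leLHS](_ : _ = (2 * (Lf * lg) ^+ 2 + 18 * (Lg ^+ 2 * lf) ^+ 2) * rho ^+ 2);
  last by ring.
move: (Lf * lg) (Lg ^+ 2 * lf) p0 q0 => p q p0 q0.
rewrite [leRHS](_ : _ = 18 * (p + q) ^+ 2 * rho ^+ 2); last by ring.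
rewrite ler_wpM2r ?sqr_ge0 //.
have := mulr_ge0 p0 q0; have := sqr_ge0 p; nra.
Qed.

End Bounds.
End Estimator.

(** * Runs of the algorithm *)

Section ConvexAverages.
Context {R : realType} {p : nat}.

(** Induction on K: the average of K + 1 points lies on the segment from the average
    of the first K to the last. *)
Lemma convex_average (C : set 'cV[R]_p) (phi : 'cV[R]_p -> R) (x : nat -> 'cV[R]_p) K :
  segment_closed C ->
  (forall y z t, C y -> C z -> 0 <= t <= 1 ->
    phi (y + t *: (z - y)) <= phi y + t * (phi z - phi y)) ->
  (0 < K)%N -> (forall t, (t < K)%N -> C (x t)) ->
  C (K%:R^-1 *: \sum_(t < K) x t) /\
  phi (K%:R^-1 *: \sum_(t < K) x t) <= K%:R^-1 * \sum_(t < K) phi (x t).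
Proof.
move=> cC cphi; elim: K => // -[_ _ Cx|K IH _ Cx].
  by rewrite !big_ord1 invr1 scale1r mul1r; split; [exact: Cx|].
have [Cm phim] := IH isT (fun t tK => Cx t (ltnW tK)); clear IH.
rewrite ![\sum_(t < K.+2) _]big_ord_recr /=.
set m := K.+1%:R^-1 *: _ in Cm phim.
pose t : R := K.+2%:R^-1.
have K2 : K.+2%:R != 0 :> R by rewrite pnatr_eq0.
have K1 : K.+1%:R != 0 :> R by rewrite pnatr_eq0.
have KE : K.+2%:R = K.+1%:R + 1 :> R by rewrite natr1.
have t01 : 0 <= t <= 1.
  by rewrite invr_ge0 ler0n /= invf_le1 ?ltr0n // ler1n.
have mE : t *: (\sum_(i < K.+1) x i + x K.+1) = m + t *: (x K.+1 - m).
  have -> : \sum_(i < K.+1) x i = K.+1%:R *: m by rewrite scalerA mulfV ?scale1r.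
  have -> : K.+1%:R = t^-1 - 1 by rewrite invrK KE addrK.
  rewrite scalerDr scalerA mulrBr mulfV ?invr_neq0 // mulr1 scalerBl scale1r.
  by rewrite scalerBr -addrA; congr (_ + _); rewrite addrC.
have Cl := Cx _ (ltnSn K.+1).
rewrite -/t mE; split; first exact: cC.
apply: (le_trans (cphi _ _ _ Cm Cl t01)).
have : (1 - t) * phi m <= (1 - t) * (K.+1%:R^-1 * \sum_(i < K.+1) phi (x i)).
  by apply: ler_wpM2l => //; case/andP: t01; lra.
have -> : (1 - t) * (K.+1%:R^-1 * \sum_(i < K.+1) phi (x i)) =
    t * \sum_(i < K.+1) phi (x i).
  rewrite mulrA; congr (_ * _).
  have -> : 1 - t = K.+1%:R / K.+2%:R.
    by apply: (mulIf K2); rewrite mulrBl mul1r mulVf // divfK // KE addrK.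
  by rewrite mulrAC mulfV // mul1r.
lra.
Qed.

Lemma sqr_dist_convex (y a b : 'cV[R]_p) (t : R) : 0 <= t <= 1 ->
  l2norm (a + t *: (b - a) - y) ^+ 2 <=
  l2norm (a - y) ^+ 2 + t * (l2norm (b - y) ^+ 2 - l2norm (a - y) ^+ 2).
Proof.
move=> /andP[t0 t1].
have -> : a + t *: (b - a) - y = (a - y) + t *: ((b - y) - (a - y)).
  by rewrite opprB addrA subrK addrAC.
move: (a - y) (b - y) => u v.
have := cauchy_schwarz u v; have := sqr_ge0 (l2norm u - l2norm v).
rewrite !l2norm_sqr !(dotDl, dotDr, dotZl, dotZr, dotBl, dotBr, dotNl, dotNr).
rewrite (dotC v u) sqrrB !l2norm_sqr => H1 H2.
have : 0 <= t * (1 - t) * (dot u u - 2 * dot u v + dot v v).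
  by rewrite mulr_ge0 ?mulr_ge0 //; lra.
lra.
Qed.

End ConvexAverages.

Lemma total_iterationsS k0 s :
  total_iterations k0 s.+1 = (total_iterations k0 s + k0 * 2 ^ s)%N.
Proof.
rewrite /total_iterations expnS mulnCA mul2n -addnn addnBAC //.
by rewrite leq_pmulr // expn_gt0.
Qed.

Lemma total_iterations_le k0 s S : (s <= S)%N ->
  (total_iterations k0 s <= total_iterations k0 S)%N.
Proof.
by move=> sS; rewrite leq_sub2r // leq_mul2l leq_exp2l // sS orbT.
Qed.

Section Algorithm.
Context {R : realType} {d k m n a b : nat} (pb : problem R d k m n).
Context (x0 : 'cV[R]_d) (k0 : nat) (eta : R) (S : nat).
Implicit Types (Ai : nat -> a.-tuple 'I_m) (Bi : nat -> b.-tuple 'I_n).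

(** One inner iteration as a function of the current draw only. *)
Definition prox_update l (xref x : 'cV[R]_d) (D : a.-tuple 'I_m * b.-tuple 'I_n) :
    'cV[R]_d :=
  prox pb (stepsize k0 eta S l)
    (x - stepsize k0 eta S l *: grad_est pb xref x D.1 D.2).

Lemma snapshot_val xref : (take_snapshot pb xref).1 =
  Snapshot xref (inner_mean pb xref) (jac_mean pb xref) (smooth_grad pb xref).
Proof.
rewrite /take_snapshot /bind /ret /= !size_enum_ord !big_enum /=.
by rewrite /smooth_grad /outer_grad /inner_mean /jac_mean /vmean !card_ord.
Qed.

Lemma step_val Ai Bi xref l x :
  (step pb k0 eta S Ai Bi (take_snapshot pb xref).1 l x).1 =
  prox_update l.+1 xref x (Ai l, Bi l).
Proof. by rewrite snapshot_val /step /bind /ret /= !size_tuple. Qed.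

Lemma snapshot_cost xref : (take_snapshot pb xref).2 = (2 * m + n)%N.
Proof.
rewrite /take_snapshot /bind /ret /= !big_const_seq !count_predT !iter_addn_0.
by rewrite !size_tuple !card_ord !mul1n addn0 mul2n -addnn addnA.
Qed.

Lemma step_cost Ai Bi sn l x :
  (step pb k0 eta S Ai Bi sn l x).2 = (4 * a + 2 * b)%N.
Proof.
rewrite /step /bind /ret /= !big_const_seq !count_predT !iter_addn_0 !size_tuple.
lia.
Qed.

Lemma iterateS Ai Bi sn l x t :
  iterate pb k0 eta S Ai Bi sn l x t.+1 =
  bind (iterate pb k0 eta S Ai Bi sn l x t) (step pb k0 eta S Ai Bi sn (l + t)).
Proof. by []. Qed.

Lemma iterate_cost Ai Bi sn l x t :
  (iterate pb k0 eta S Ai Bi sn l x t).2 = (t * (4 * a + 2 * b))%N.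
Proof.
elim: t => // t IH; rewrite iterateS /bind step_cost IH mulSn; exact: addnC.
Qed.

Lemma step_local Ai Bi Ai' Bi' sn l : Ai l = Ai' l -> Bi l = Bi' l ->
  step pb k0 eta S Ai Bi sn l = step pb k0 eta S Ai' Bi' sn l.
Proof. by rewrite /step => -> ->. Qed.

Lemma iterate_local Ai Bi Ai' Bi' sn l x t :
  (forall i, (i < l + t)%N -> Ai i = Ai' i /\ Bi i = Bi' i) ->
  iterate pb k0 eta S Ai Bi sn l x t = iterate pb k0 eta S Ai' Bi' sn l x t.
Proof.
elim: t => [//|t IH H].
have [HA HB] : Ai (l + t)%N = Ai' (l + t)%N /\ Bi (l + t)%N = Bi' (l + t)%N.
  by apply: H; rewrite addnS.
rewrite !iterateS (step_local _ HA HB) IH; first by [].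
by move=> i it; apply: H; rewrite addnS ltnW.
Qed.

Lemma epochs_count Ai Bi s :
  st_count (epochs pb x0 k0 eta S Ai Bi s).1 = total_iterations k0 s.
Proof.
elim: s => [|s IH]; first by rewrite /total_iterations muln1 subnn.
by rewrite total_iterationsS -IH.
Qed.

Lemma epochsS Ai Bi s :
  epochs pb x0 k0 eta S Ai Bi s.+1 =
  bind (epochs pb x0 k0 eta S Ai Bi s) (epoch pb k0 eta S Ai Bi (k0 * 2 ^ s)).
Proof. by []. Qed.

Lemma epoch_local Ai Bi Ai' Bi' K st :
  (forall i, (i < st_count st + K)%N -> Ai i = Ai' i /\ Bi i = Bi' i) ->
  epoch pb k0 eta S Ai Bi K st = epoch pb k0 eta S Ai' Bi' K st.
Proof.
move=> H.
have loc sn x t : (t <= K)%N ->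
    iterate pb k0 eta S Ai Bi sn (st_count st) x t =
    iterate pb k0 eta S Ai' Bi' sn (st_count st) x t.
  move=> tK; apply: iterate_local => i it; apply: H.
  by rewrite (leq_trans it) // leq_add2l.
have sumloc sn x :
    \sum_(t < K) (iterate pb k0 eta S Ai Bi sn (st_count st) x t).1 =
    \sum_(t < K) (iterate pb k0 eta S Ai' Bi' sn (st_count st) x t).1.
  by apply: eq_bigr => t _; rewrite (loc _ _ t (ltnW (ltn_ord t))).
rewrite /epoch /bind /ret [in LHS]sumloc [in LHS](loc _ _ K (leqnn K)).
reflexivity.
Qed.

(** What the first s epochs compute depends only on the draws made in them; this is
    what makes later draws independent of it. *)
Lemma epochs_local Ai Bi Ai' Bi' s :
  (forall i, (i < total_iterations k0 s)%N -> Ai i = Ai' i /\ Bi i = Bi' i) ->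
  epochs pb x0 k0 eta S Ai Bi s = epochs pb x0 k0 eta S Ai' Bi' s.
Proof.
elim: s => [//|s IH H]; rewrite !epochsS IH; last first.
  by move=> i it; apply: H; rewrite total_iterationsS ltn_addr.
rewrite /bind; set st := (epochs _ _ _ _ _ _ _ _).1.
rewrite (@epoch_local Ai Bi Ai' Bi'); first by [].
by move=> i; rewrite /st epochs_count -total_iterationsS; exact: H.
Qed.

(** A convex set that contains the starting point and all prox outputs contains
    every point that the algorithm computes. *)
Lemma epochs_in (C : set 'cV[R]_d) Ai Bi e :
  (0 < k0)%N -> segment_closed C -> C x0 ->
  (forall l r x D, (l <= total_iterations k0 S)%N -> C (prox_update l r x D)) ->
  (e <= S)%N ->
  let st := (epochs pb x0 k0 eta S Ai Bi e).1 in
  [/\ C (st_ref st), C (st_last st) & (e < S)%N ->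
    forall t, (t <= k0 * 2 ^ e)%N ->
    C (iterate pb k0 eta S Ai Bi (take_snapshot pb (st_ref st)).1
      (total_iterations k0 e) (st_last st) t).1].
Proof.
move=> k00 cC Cx0 Cprox; elim: e => [_ st|e IH eS st].
  split=> // S0 [_|t tK] //; rewrite iterateS /bind step_val; apply: Cprox.
  rewrite (leq_trans _ (total_iterations_le k0 S0)) //.
  by rewrite total_iterationsS ltn_add2l.
have [_ _ /(_ eS) H] := IH (ltnW eS).
have K0 : (0 < k0 * 2 ^ e)%N by rewrite muln_gt0 k00 expn_gt0.
have Cl : C (st_last st).
  rewrite /st epochsS {1}/bind /epoch {1}/bind {1}/bind /ret.
  by rewrite (epochs_count Ai Bi e); exact: H.
split=> //.
  rewrite /st epochsS {1}/bind /epoch {1}/bind {1}/bind /ret.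
  rewrite (epochs_count Ai Bi e).
  (* Only membership is wanted, so any convex function will do. *)
  have [] // := convex_average (phi := fun=> 0) cC _ K0 (fun t tK => H t (ltnW tK)).
  by move=> *; rewrite subrr mulr0 addr0.
move=> eS' [_|t tK] //; rewrite iterateS /bind step_val; apply: Cprox.
rewrite (leq_trans _ (total_iterations_le k0 eS')) //.
by rewrite [leqRHS]total_iterationsS ltn_add2l.
Qed.

Lemma epoch_cost Ai Bi K st :
  (epoch pb k0 eta S Ai Bi K st).2 = (2 * m + n + K * (4 * a + 2 * b))%N.
Proof. by rewrite /epoch /bind snapshot_cost iterate_cost addn0. Qed.

Lemma epochs_cost Ai Bi s :
  (epochs pb x0 k0 eta S Ai Bi s).2 =
  (s * (2 * m + n) + total_iterations k0 s * (4 * a + 2 * b))%N.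
Proof.
elim: s => [|s IH]; first by rewrite /total_iterations muln1 subnn.
rewrite total_iterationsS epochsS /bind IH epoch_cost mulSn mulnDl addnACA; congr (_ + _)%N; exact: addnC.
Qed.

End Algorithm.

(** * A Gronwall inequality over epochs *)

Section Recursion.
Context {R : realType}.
Context (S : nat) (len off : nat -> nat) (dist gap : nat -> nat -> R).
Context (rdist : nat -> R) (wt : nat -> R) (w gam D2 C0 k1 k2 : R).
Hypothesis len_gt0 : forall s, (0 < len s)%N.
Hypothesis off0 : off 0%N = 0%N.
Hypothesis offS : forall s, off s.+1 = (off s + len s)%N.
Hypothesis w_gt0 : 0 < w.
Hypothesis wt_ge : forall l, (l <= off S)%N -> w <= wt l.
Hypothesis wt_decr : forall l, (l < off S)%N -> wt l.+1 <= wt l.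
Hypothesis gam_ge0 : 0 <= gam.
Hypothesis k1_ge0 : 0 <= k1.
Hypothesis k2_ge0 : 0 <= k2.
Hypothesis k_gam : k1 + k2 <= w * gam.
Hypothesis dist_ge0 : forall s t, 0 <= dist s t.
Hypothesis gap_ge0 : forall s t, (s < S)%N -> (t <= len s)%N -> 0 <= gap s t.
Hypothesis D2_ge0 : 0 <= D2.
Hypothesis dist_init : dist 0 0 <= D2.
Hypothesis rdist_init : rdist 0 <= D2.
Hypothesis gap_init : gap 0 0 + wt 0 * dist 0 0 <= C0 + w * D2.
Hypothesis step_rec : forall s t, (s < S)%N -> (t < len s)%N ->
  gap s t.+1 + wt (off s + t).+1 * dist s t.+1 <=
  (wt (off s + t).+1 + k1) * dist s t + k2 * rdist s.
Hypothesis dist_next : forall s, (s < S)%N -> dist s.+1 0 = dist s (len s).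
Hypothesis gap_next : forall s, (s < S)%N -> gap s.+1 0 = gap s (len s).
Hypothesis rdist_next : forall s, (s < S)%N ->
  rdist s.+1 <= (len s)%:R^-1 * \sum_(t < len s) dist s t.

Let M l := D2 * (1 + gam) ^+ l.

Let gam1 : 1 <= 1 + gam. Proof. by rewrite lerDl. Qed.

Let M_ge0 l : 0 <= M l.
Proof. by rewrite mulr_ge0 // exprn_ge0 // (le_trans ler01 gam1). Qed.

Let M_mono i j : (i <= j)%N -> M i <= M j.
Proof. by move=> ij; rewrite ler_wpM2l // ler_weXn2l. Qed.

Let MS l : M l.+1 = M l + gam * M l.
Proof. by rewrite /M exprS; ring. Qed.

Let off_le i j : (i <= j)%N -> (off i <= off j)%N.
Proof.
elim: j => [|j IH]; first by rewrite leqn0 => /eqP ->.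
rewrite leq_eqVlt => /orP[/eqP -> //|/IH H].
by rewrite offS (leq_trans H) // leq_addr.
Qed.

(** The distances may grow, but at most by the factor 1 + gam per step, and all
    the errors together are paid by w times that growth. *)
Let within_epoch s : (s < S)%N ->
  dist s 0 <= M (off s) -> rdist s <= M (off s) ->
  gap s 0 + wt (off s) * dist s 0 <= C0 + w * M (off s) ->
  forall t, (t <= len s)%N ->
    dist s t <= M (off s + t) /\
    gap s t + wt (off s + t) * dist s t + \sum_(i < t) gap s i <=
      C0 + w * M (off s + t).
Proof.
move=> sS H1 H2 H3; elim=> [_|t IH tK].
  by rewrite addn0 big_ord0 addr0.
have [IH1 IH2] := IH (ltnW tK).
have lS : (off s + t < off S)%N.
  by apply: leq_trans (off_le sS); rewrite offS ltn_add2l.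
set l := (off s + t)%N in IH1 IH2 lS *; rewrite addnS -/l.
have Hs := step_rec sS tK; rewrite -/l in Hs.
have wl := wt_ge lS; have wd := wt_decr lS.
have dl0 := dist_ge0 s t; have dl1 := dist_ge0 s t.+1.
have g1 := gap_ge0 sS tK.
have H4 : k1 * dist s t + k2 * rdist s <= w * gam * M l.
  have r1 : rdist s <= M l by apply: (le_trans H2); rewrite M_mono ?leq_addr.
  have := ler_wpM2l k1_ge0 IH1; have := ler_wpM2l k2_ge0 r1.
  have := ler_wpM2r (M_ge0 l) k_gam; lra.
have gM : 0 <= gam * M l by rewrite mulr_ge0.
have wl0 : 0 < wt l.+1 by exact: lt_le_trans wl.
rewrite MS; split.
  rewrite -(ler_pM2l wl0).
  have := ler_wpM2r gM wl; have := ler_wpM2l (ltW wl0) IH1; lra.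
rewrite big_ord_recr /=.
have := ler_wpM2r dl0 wd; lra.
Qed.

Let epoch_start s : (s <= S)%N ->
  [/\ dist s 0 <= M (off s), rdist s <= M (off s) &
  gap s 0 + wt (off s) * dist s 0 <= C0 + w * M (off s)].
Proof.
elim: s => [_|s IH sS]; first by rewrite off0 /M expr0 mulr1.
have [H1 H2 H3] := IH (ltnW sS).
have HW := within_epoch sS H1 H2 H3.
have [E1 E2] := HW _ (leqnn _); rewrite dist_next // gap_next // offS; split=> //.
  apply: (le_trans (rdist_next sS)).
  rewrite mulrC ler_pdivrMr ?ltr0n // mulr_natr -[X in _ *+ X]card_ord -sumr_const.
  apply: ler_sum => t _; have [Ht _] := HW t (ltnW (ltn_ord t)).
  by apply: (le_trans Ht); rewrite M_mono // leq_add2l ltnW.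
apply: le_trans E2; rewrite lerDl; apply: sumr_ge0 => t _.
by rewrite gap_ge0 // ltnW.
Qed.

(** The reference point of an epoch is an average of earlier iterates, so that the
    bound on the distances, being monotone in time, covers it as well. *)
Lemma epoch_gap_sum s : (s < S)%N ->
  \sum_(t < len s) gap s t <= C0 + w * D2 * (1 + gam) ^+ off s.+1.
Proof.
move=> sS; have [H1 H2 H3] := epoch_start (ltnW sS).
have [_ H] := within_epoch sS H1 H2 H3 (leqnn _).
rewrite offS -mulrA; apply: le_trans H; rewrite lerDr addr_ge0 ?gap_ge0 //.
rewrite mulr_ge0 // (le_trans (ltW w_gt0)) // wt_ge //.
by rewrite -offS off_le.
Qed.

End Recursion.

Section Numerics.
Context {R : realType}.

(** The factor is at most exp(8/5), and exp(1/20) <= 20/19 is squared five times. *)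
Lemma growth_bound (gam : R) T : 0 <= gam -> gam * T%:R <= 8 / 5 ->
  (1 + gam) ^+ T <= 21 / 4.
Proof.
move=> g0 gT; apply: (@le_trans _ _ (expR (8 / 5))).
  apply: (@le_trans _ _ (expR gam ^+ T)).
    by rewrite lerXn2r ?nnegrE ?expR_ge0 ?addr_ge0 ?expR_ge1Dx.
  by rewrite -expRM_natl ler_expR mulrC.
have -> : (8 / 5 : R) = 32%:R * (1 / 20) by lra.
rewrite expRM_natl.
have e1 : expR (1 / 20 : R) <= 20 / 19.
  have := expR_ge1Dx (- (1 / 20) : R); rewrite expRN => H.
  have e0 : 0 < expR (1 / 20 : R) by exact: expR_gt0.
  have : expR (1 / 20) * (1 + - (1 / 20)) <= expR (1 / 20 : R) * (expR (1 / 20))^-1.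
    by rewrite ler_wpM2l // ltW.
  rewrite mulfV ?gt_eqF //; lra.
have e2 : expR (1 / 20 : R) ^+ 2 <= 1109 / 1000.
  apply: (@le_trans _ _ ((20 / 19) ^+ 2)); last by lra.
  by rewrite lerXn2r ?nnegrE ?expR_ge0.
have up (x y z : R) : 0 <= x -> x <= y -> y ^+ 2 <= z -> x ^+ 2 <= z.
  move=> x0 xy; apply: le_trans; rewrite lerXn2r ?nnegrE //; lra.
have e4 : expR (1 / 20 : R) ^+ 4 <= 1230 / 1000.
  rewrite (exprM _ 2 2); apply: (up _ _ _ _ e2); last by lra.
  by rewrite exprn_ge0 ?expR_ge0.
have e8 : expR (1 / 20 : R) ^+ 8 <= 1513 / 1000.
  rewrite (exprM _ 4 2); apply: (up _ _ _ _ e4); last by lra.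
  by rewrite exprn_ge0 ?expR_ge0.
have e16 : expR (1 / 20 : R) ^+ 16 <= 2290 / 1000.
  rewrite (exprM _ 8 2); apply: (up _ _ _ _ e8); last by lra.
  by rewrite exprn_ge0 ?expR_ge0.
rewrite (exprM _ 16 2); apply: (up _ _ _ _ e16); last by lra.
by rewrite exprn_ge0 ?expR_ge0.
Qed.

(** The number of epochs is the one for which the power of two first exceeds x. *)
Lemma floor_log2P (x : R) (S : nat) : 0 < x ->
  S%:Z = Num.floor (ln x / ln 2) + 1 -> x < 2 ^+ S /\ 2 ^+ S <= 2 * x.
Proof.
move=> x0 SE; have l2 : 0 < ln (2 : R) by rewrite ln_gt0 // ltr1n.
have fE : Num.floor (ln x / ln 2) = S%:Z - 1 by rewrite SE addrK.
have /andP[H1 H2] := Num.Theory.real_floor_itv (num_real (ln x / ln (2 : R))).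
rewrite fE in H1 H2.
have e2 : ln ((2 : R) ^+ S) = S%:R * ln 2 by rewrite lnXn // mulr_natl.
split.
  rewrite -ltr_ln ?posrE ?exprn_gt0 // e2 -ltr_pdivrMr //.
  by move: H2; rewrite subrK.
rewrite -ler_ln ?posrE ?exprn_gt0 ?mulr_gt0 // lnM ?posrE // e2.
move: H1; rewrite intrB ler_pdivlMr //; lra.
Qed.

End Numerics.

(** * Expected objective gap *)

Section Expectation.
Context {R : realType} {d k m n a b : nat} (pb : problem R d k m n).
Context (Lf lf Lg lg : R) (Hpb : assumptions pb Lf lf Lg lg).
Context (m0 : (0 < m)%N) (n0 : (0 < n)%N) (a0 : (0 < a)%N) (b0 : (0 < b)%N).
Context (x0 xs : 'cV[R]_d) (k0 : nat) (eta : R) (S : nat).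
Context (k00 : (0 < k0)%N) (eta0 : 0 < eta).

Let X := feas pb.
Let ell := Lf * lg + Lg ^+ 2 * lf.
Let cX : segment_closed X := convex_segment (feas_convex Hpb).
Let draw : finType := (a.-tuple 'I_m * b.-tuple 'I_n)%type.
Let T := total_iterations k0 S.

Definition dom_obj : set 'cV[R]_d := [set x | feas pb x /\ (reg pb x < +oo)%E].

Lemma dom_obj_segment : segment_closed dom_obj.
Proof.
move=> x y t [Xx rx] [Xy ry] t01; split; first exact: cX.
by have [] := regr_convex Hpb rx ry t01.
Qed.

Lemma objr_convex x y t : dom_obj x -> dom_obj y -> 0 <= t <= 1 ->
  objr pb (x + t *: (y - x)) <= objr pb x + t * (objr pb y - objr pb x).
Proof.
move=> [Xx rx] [Xy ry] t01; have [_ H1] := regr_convex Hpb rx ry t01.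
have H2 := smooth_part_segment Hpb Xx Xy t01.
rewrite /objr; lra.
Qed.

Context (x0_dom : dom_obj x0) (xs_dom : dom_obj xs).
Context (xs_min : forall x, dom_obj x -> objr pb xs <= objr pb x).

Let Dr1 : (0 < #|draw|)%N.
Proof. by rewrite card_prod !card_tuple muln_gt0 !expn_gt0 !card_ord m0 n0. Qed.

Lemma prox_update_dom l r x (D : draw) : 0 < stepsize k0 eta S l ->
  dom_obj (prox_update pb k0 eta S l r x D).
Proof.
move=> s0; case: xs_dom => Xs rs.
by split; [exact: (prox_feas Hpb) | exact: (prox_fin Hpb _ s0 Xs rs)].
Qed.

(** Bias and second moment both involve |x - r|, which the triangle inequality splits
    into the distances of x and of r to the minimizer. *)
Lemma avg_prox_update l r x (c nu w : R) : X r -> X x ->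
  0 < stepsize k0 eta S l -> w = (2 * stepsize k0 eta S l)^-1 ->
  ell / Num.sqrt a%:R <= c -> ell / 2 < w ->
  ell ^+ 2 * (b%:R^-1 + 18 / a%:R) <= nu * (4 * (w - ell / 2)) ->
  avg (fun D : draw => objr pb (prox_update pb k0 eta S l r x D) - objr pb xs +
    w * l2norm (prox_update pb k0 eta S l r x D - xs) ^+ 2) <=
  (w + (3 / 2 * c + 2 * nu)) * l2norm (x - xs) ^+ 2 +
  (c / 2 + 2 * nu) * l2norm (r - xs) ^+ 2.
Proof.
move=> Xr Xx s0 wE ellc ellw var; case: xs_dom => Xs rs.
have V0 : tangent X 0 by rewrite -(subrr x); exact: tangentB.
have [Q [VQ QV]] := exists_proj V0 (fun u v => tangentD cX) (@tangentZ _ _ X).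
set e := fun D : draw => smooth_grad pb x - grad_est pb r x D.1 D.2.
have w4 : 0 < 4 * (w - ell / 2) by rewrite mulr_gt0 // subr_gt0.
have D1 : (0 < #|draw|)%N := Dr1.
have le1 : avg (fun D : draw => objr pb (prox_update pb k0 eta S l r x D) - objr pb xs +
    w * l2norm (prox_update pb k0 eta S l r x D - xs) ^+ 2) <=
  avg (fun D : draw => w * l2norm (x - xs) ^+ 2 + dot (e D) (x - xs) +
    l2norm (Q *m e D) ^+ 2 / (4 * (w - ell / 2))).
  apply: ler_avg => D.
  exact: (prox_step_descent_proj Hpb m0 n0 VQ QV s0 Xx Xs rs wE (erefl _) ellw).
apply: (le_trans le1); rewrite !avgD avg_cst // avgZr.
have bias : avg (fun D : draw => dot (e D) (x - xs)) <=
    c * (l2norm (x - r) * l2norm (x - xs)).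
  rewrite avg_pair /=.
  apply: (le_trans (grad_est_bias Hpb m0 n0 a0 b0 Xr Xx (tangentB Xx Xs))).
  by rewrite -mulrA ler_wpM2r // mulr_ge0 ?l2norm_ge0.
have sqr : avg (fun D : draw => l2norm (Q *m e D) ^+ 2) / (4 * (w - ell / 2)) <=
    nu * l2norm (x - r) ^+ 2.
  rewrite ler_pdivrMr // avg_pair /=.
  apply: (le_trans (grad_est_sqr Hpb m0 n0 a0 b0 Xr Xx VQ)); rewrite -/ell.
  rewrite [leLHS](_ : _ = ell ^+ 2 * (b%:R^-1 + 18 / a%:R) * l2norm (x - r) ^+ 2);
    last by ring.
  by rewrite [leRHS]mulrAC ler_wpM2r ?sqr_ge0.
have tri : l2norm (x - r) <= l2norm (x - xs) + l2norm (r - xs).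
  by rewrite (le_trans (l2norm_dist_triangle _ xs _)) // (l2normBC xs).
have c0 : 0 <= c.
  apply: le_trans ellc; rewrite divr_ge0 ?sqrtr_ge0 //.
  exact: (ell_ge0 Hpb).
have nu0 : 0 <= nu.
  have : 0 <= nu * (4 * (w - ell / 2)).
    by apply: le_trans var; rewrite mulr_ge0 ?sqr_ge0 // addr_ge0 ?invr_ge0 ?divr_ge0.
  by rewrite pmulr_lge0.
have := l2norm_ge0 (x - xs); have := l2norm_ge0 (r - xs); have := l2norm_ge0 (x - r).
move: bias sqr tri; set rho := l2norm (x - r); set p := l2norm (x - xs).
set q := l2norm (r - xs) => bias sqr tri rho0 q0 p0.
have H1 : rho * p <= 3 / 2 * p ^+ 2 + 1 / 2 * q ^+ 2.
  have : rho * p <= (p + q) * p by rewrite ler_wpM2r.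
  have := sqr_ge0 (p - q); rewrite sqrrB; nra.
have H2 : rho ^+ 2 <= 2 * p ^+ 2 + 2 * q ^+ 2.
  have : rho ^+ 2 <= (p + q) ^+ 2 by rewrite lerXn2r ?nnegrE ?addr_ge0.
  have := sqr_ge0 (p - q); rewrite sqrrB sqrrD; lra.
have := ler_wpM2l c0 H1; have := ler_wpM2l nu0 H2; lra.
Qed.

Context (D0 : draw).
Implicit Types (s : T.-tuple draw).

Definition run s e : state (R := R) (d := d) :=
  (epochs pb x0 k0 eta S (fun l => (nth D0 s l).1) (fun l => (nth D0 s l).2) e).1.

Definition inner_iter s e t : 'cV[R]_d :=
  (iterate pb k0 eta S (fun l => (nth D0 s l).1) (fun l => (nth D0 s l).2)
    (take_snapshot pb (st_ref (run s e))).1 (total_iterations k0 e)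
    (st_last (run s e)) t).1.

Lemma inner_iterS s e t : inner_iter s e t.+1 =
  prox_update pb k0 eta S (total_iterations k0 e + t).+1 (st_ref (run s e))
    (inner_iter s e t) (nth D0 s (total_iterations k0 e + t)).
Proof.
rewrite /inner_iter iterateS /bind step_val; congr prox_update.
by case: (nth _ _ _).
Qed.

Lemma run_ref s e : st_ref (run s e.+1) =
  (k0 * 2 ^ e)%:R^-1 *: \sum_(t < (k0 * 2 ^ e)%N) inner_iter s e t.
Proof.
rewrite {1}/run epochsS {1}/bind /epoch {1}/bind {1}/bind /ret.
by rewrite (epochs_count pb x0 k0 eta S _ _ e).
Qed.

Lemma run_last s e : st_last (run s e.+1) = inner_iter s e (k0 * 2 ^ e)%N.
Proof.
rewrite {1}/run epochsS {1}/bind /epoch {1}/bind {1}/bind /ret.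
by rewrite (epochs_count pb x0 k0 eta S _ _ e).
Qed.

Lemma nth_tset (i : 'I_T) (D : draw) s (l : nat) : (l < i)%N ->
  nth D0 (tset i D s) l = nth D0 s l.
Proof.
move=> li; have lT : (l < T)%N := ltn_trans li (ltn_ord i).
rewrite -(tnth_nth D0 _ (Ordinal lT)) -(tnth_nth D0 _ (Ordinal lT)) tnth_mktuple.
by case: eqP => // E; move: li; rewrite -E ltnn.
Qed.

(** Redrawing iteration i does not affect what was computed before it. *)
Lemma run_tset (i : 'I_T) (D : draw) s e : (total_iterations k0 e <= i)%N ->
  run (tset i D s) e = run s e.
Proof.
move=> ei; rewrite /run (@epochs_local _ _ _ _ _ _ _ pb x0 k0 eta S _ _
  (fun l => (nth D0 s l).1) (fun l => (nth D0 s l).2) e); first by [].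
by move=> l le; rewrite nth_tset // (leq_trans le).
Qed.

Lemma inner_iter_tset (i : 'I_T) (D : draw) s e t :
  (total_iterations k0 e + t <= i)%N ->
  inner_iter (tset i D s) e t = inner_iter s e t.
Proof.
move=> ei; rewrite /inner_iter run_tset; last by rewrite (leq_trans _ ei) // leq_addr.
rewrite (@iterate_local _ _ _ _ _ _ _ pb k0 eta S _ _
  (fun l => (nth D0 s l).1) (fun l => (nth D0 s l).2)); first by [].
by move=> l le; rewrite nth_tset // (leq_trans le).
Qed.

Lemma stepsize_gt0 l : (l <= T)%N -> (0 < T)%N -> 0 < stepsize k0 eta S l.
Proof.
move=> lT T0; rewrite /stepsize -/T.
have T0' : (0 : R) < T%:R by rewrite ltr0n.
have lT' : (l%:R : R) <= T%:R by rewrite ler_nat.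
by rewrite divr_gt0 ?mulr_gt0 ?sqrtr_gt0 //; lra.
Qed.

Lemma stepsize_decr l : (l < T)%N ->
  (2 * stepsize k0 eta S l.+1)^-1 <= (2 * stepsize k0 eta S l)^-1.
Proof.
move=> lT; have T0 : (0 < T)%N by rewrite (leq_ltn_trans _ lT).
have T0' : (0 : R) < T%:R by rewrite ltr0n.
have lT' : (l.+1%:R : R) <= T%:R by rewrite ler_nat.
have p0 := mulr_gt0 (ltr0Sn R 1) (stepsize_gt0 (ltnW lT) T0).
have p1 := mulr_gt0 (ltr0Sn R 1) (stepsize_gt0 lT T0).
rewrite lef_pV2 ?posrE //.
rewrite ler_pM2l // /stepsize -/T ler_wpM2l ?mulr_ge0 ?sqrtr_ge0 ?(ltW eta0) //.
have S1 : (l.+1%:R : R) = l%:R + 1 by rewrite natr1.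
have u0 : 0 < 2 * T%:R - l.+1%:R :> R by lra.
have v0 : 0 < 2 * T%:R - l%:R :> R by lra.
rewrite lef_pV2 ?posrE ?sqrtr_gt0 // ler_sqrt //; lra.
Qed.

Lemma stepsize_le l : (l <= T)%N -> (0 < T)%N ->
  (2 * eta)^-1 <= (2 * stepsize k0 eta S l)^-1.
Proof.
move=> lT T0.
have T0' : (0 : R) < T%:R by rewrite ltr0n.
have lT' : (l%:R : R) <= T%:R by rewrite ler_nat.
have p0 := mulr_gt0 (ltr0Sn R 1) (stepsize_gt0 lT T0).
have e0 : 0 < 2 * eta by rewrite mulr_gt0.
rewrite lef_pV2 ?posrE // ler_pM2l //.
rewrite /stepsize -/T -mulrA -[leRHS]mulr1 ler_wpM2l ?(ltW eta0) //.
have v0 : 0 < 2 * T%:R - l%:R :> R by lra.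
rewrite ler_pdivrMr ?sqrtr_gt0 // mul1r ler_sqrt //; lra.
Qed.

(** The step sizes vary by a factor sqrt 2 over the whole run. *)
Lemma stepsize0 : (0 < T)%N ->
  (2 * stepsize k0 eta S 0)^-1 <= 3 / 2 * (2 * eta)^-1.
Proof.
move=> T0.
have T0' : (0 : R) < T%:R by rewrite ltr0n.
have s0 := mulr_gt0 (ltr0Sn R 1) (stepsize_gt0 (leq0n _) T0).
have e0 : 0 < (3 / 2)^-1 * (2 * eta) by rewrite mulr_gt0 ?invr_gt0 ?mulr_gt0 ?divr_gt0.
rewrite -[3 / 2]invrK -invfM lef_pV2 ?posrE //.
rewrite mulrCA ler_pM2l // /stepsize -/T subr0 sqrtrM // -mulrA.
have sT : 0 < Num.sqrt (T%:R : R) by rewrite sqrtr_gt0.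
rewrite [_ / (_ * _)](_ : _ = (Num.sqrt 2)^-1); last first.
  by rewrite [(_ * Num.sqrt T%:R)^-1]invfM mulrCA mulfV ?mulr1 // gt_eqF.
rewrite mulrC ler_wpM2l ?(ltW eta0) //.
have s2 : Num.sqrt (2 : R) <= 3 / 2.
  by rewrite -ler_sqr ?nnegrE ?sqrtr_ge0 // sqr_sqrtr //; lra.
by rewrite lef_pV2 ?posrE ?sqrtr_gt0.
Qed.

Lemma iter_dom s e : (0 < T)%N -> (e <= S)%N ->
  [/\ dom_obj (st_ref (run s e)), dom_obj (st_last (run s e)) &
    (e < S)%N -> forall t, (t <= k0 * 2 ^ e)%N -> dom_obj (inner_iter s e t)].
Proof.
move=> T0; apply: epochs_in => // [|l r x D lT]; first exact: dom_obj_segment.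
by apply: prox_update_dom; exact: stepsize_gt0.
Qed.

(** Conditioning on the past is the resampling of one draw; the recursion over epochs
    then applies to the averages over all draws. *)
Lemma expected_gap (c nu gam D2 DPhi : R) : (0 < S)%N ->
  let w := (2 * eta)^-1 in
  ell / Num.sqrt a%:R <= c -> ell / 2 < w -> 0 <= nu ->
  ell ^+ 2 * (b%:R^-1 + 18 / a%:R) <= nu * (4 * (w - ell / 2)) ->
  0 <= gam -> 2 * c + 4 * nu <= w * gam ->
  l2norm (x0 - xs) ^+ 2 <= D2 -> objr pb x0 - objr pb xs <= DPhi ->
  avg (fun s => objr pb (st_ref (run s S)) - objr pb xs) <=
  (DPhi + 1 / 2 * w * D2 + w * D2 * (1 + gam) ^+ T) / (k0 * 2 ^ S.-1)%:R.
Proof.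
move=> S0 w ellc ellw nu0 var gam0 cw hD hPhi.
have T0 : (0 < T)%N.
  rewrite (leq_trans _ (total_iterations_le k0 S0)) // total_iterationsS.
  by rewrite addn_gt0 muln_gt0 k00 orbT.
have K0 e : (0 < k0 * 2 ^ e)%N by rewrite muln_gt0 k00 expn_gt0.
have w0 : 0 < w by rewrite invr_gt0 mulr_gt0.
have c0 : 0 <= c.
  apply: le_trans ellc; rewrite divr_ge0 ?sqrtr_ge0 //.
  exact: (ell_ge0 Hpb).
have Tt : (0 < #|{: T.-tuple draw}|)%N by rewrite card_tuple expn_gt0 Dr1.
pose dist e t := avg (fun s => l2norm (inner_iter s e t - xs) ^+ 2).
pose gap e t := avg (fun s => objr pb (inner_iter s e t) - objr pb xs).
pose rdist e := avg (fun s => l2norm (st_ref (run s e) - xs) ^+ 2).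
pose wt l := (2 * stepsize k0 eta S l)^-1.
have lenT e t : (e < S)%N -> (t < k0 * 2 ^ e)%N -> (total_iterations k0 e + t < T)%N.
  move=> eS tK; rewrite (leq_trans _ (total_iterations_le k0 eS)) //.
  by rewrite total_iterationsS ltn_add2l.
have step_rec e t : (e < S)%N -> (t < k0 * 2 ^ e)%N ->
    gap e t.+1 + wt (total_iterations k0 e + t).+1 * dist e t.+1 <=
    (wt (total_iterations k0 e + t).+1 + (3 / 2 * c + 2 * nu)) * dist e t +
    (c / 2 + 2 * nu) * rdist e.
  move=> eS tK; have lT := lenT e t eS tK.
  set l := (total_iterations k0 e + t)%N in lT *.
  pose F s (D : draw) :=
    objr pb (prox_update pb k0 eta S l.+1 (st_ref (run s e)) (inner_iter s e t) D) -
    objr pb xs + wt l.+1 *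
    l2norm (prox_update pb k0 eta S l.+1 (st_ref (run s e)) (inner_iter s e t) D - xs) ^+ 2.
  have -> : gap e t.+1 + wt l.+1 * dist e t.+1 =
      avg (fun s => F s (tnth s (Ordinal lT))).
    rewrite -avgZ -avgD; apply: eq_avg => s.
    by rewrite inner_iterS (tnth_nth D0).
  rewrite (avg_resample (i := Ordinal lT) Dr1); last first.
    move=> s D D'; rewrite /F run_tset ?inner_iter_tset //=.
    by rewrite leq_addr.
  rewrite -!avgZ -avgD; apply: ler_avg => s.
  have [[Xr _] _ /(_ eS)/(_ _ (ltnW tK))[Xx _]] := iter_dom s T0 (ltnW eS).
  have s0 := stepsize_gt0 lT T0; have wl := stepsize_le lT T0.
  apply: (avg_prox_update Xr Xx s0 (erefl _) ellc); first exact: lt_le_trans wl.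
  by apply: (le_trans var); rewrite ler_wpM2l // ler_pM2l // lerD2r.
have dist0 : dist 0%N 0%N = l2norm (x0 - xs) ^+ 2 by rewrite -[RHS](avg_cst _ Tt).
have gap0 : gap 0%N 0%N = objr pb x0 - objr pb xs by rewrite -[RHS](avg_cst _ Tt).
have rdist0 : rdist 0%N = l2norm (x0 - xs) ^+ 2 by rewrite -[RHS](avg_cst _ Tt).
have conv e s : (e < S)%N -> forall t, (t < k0 * 2 ^ e)%N -> dom_obj (inner_iter s e t).
  move=> eS t tK; have [_ _ /(_ eS)] := iter_dom s T0 (ltnW eS).
  by apply; exact: ltnW.
have gap_sum : \sum_(t < (k0 * 2 ^ S.-1)%N) gap S.-1 t <=
    (DPhi + 1 / 2 * w * D2) + w * D2 * (1 + gam) ^+ total_iterations k0 S.-1.+1.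
  apply: (@epoch_gap_sum _ S (fun e => k0 * 2 ^ e)%N (total_iterations k0)
    dist gap rdist wt w gam D2 (DPhi + 1 / 2 * w * D2)
    (3 / 2 * c + 2 * nu) (c / 2 + 2 * nu)) => //.
  - by rewrite /total_iterations muln1 subnn.
  - by move=> e; exact: total_iterationsS.
  - by move=> l lT; exact: stepsize_le.
  - by move=> l lT; exact: stepsize_decr.
  - by lra.
  - by lra.
  - by lra.
  - by move=> e t; apply: avg_ge0 => s; exact: sqr_ge0.
  - move=> e t eS tK; apply: avg_ge0 => s; rewrite subr_ge0; apply: xs_min.
    by have [_ _ /(_ eS)] := iter_dom s T0 (ltnW eS); apply.
  - by apply: le_trans hD; exact: sqr_ge0.
  - by rewrite dist0.
  - by rewrite rdist0.
  - rewrite gap0 dist0; have := stepsize0 T0; rewrite -/(wt 0%N) -/w => wt0.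
    have : wt 0%N * l2norm (x0 - xs) ^+ 2 <= 3 / 2 * w * D2.
      apply: ler_pM; rewrite ?sqr_ge0 //.
      exact: (le_trans (ltW w0) (stepsize_le (leq0n _) T0)).
    lra.
  - move=> e eS; apply: eq_avg => s.
    by rewrite -run_last.
  - move=> e eS; apply: eq_avg => s.
    by rewrite -run_last.
  - move=> e eS; rewrite /dist -avg_sum -avgZ; apply: ler_avg => s.
    rewrite run_ref.
    have [] := convex_average (C := setT) (phi := fun u => l2norm (u - xs) ^+ 2)
      (x := inner_iter s e) (fun _ _ _ _ _ _ => I) _ (K0 e) (fun _ _ => I) => //.
    by move=> y z t _ _ t01; exact: sqr_dist_convex.
  by rewrite prednK.
rewrite prednK // in gap_sum.
have S1 : (S.-1 < S)%N by rewrite prednK.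
rewrite ler_pdivlMr ?ltr0n //; apply: le_trans gap_sum.
rewrite mulrC -ler_pdivlMl ?ltr0n // /gap -avg_sum -avgZ; apply: ler_avg => s.
rewrite -[in st_ref _](prednK S0) run_ref.
have [_ H] := convex_average dom_obj_segment objr_convex (K0 S.-1) (conv _ s S1).
rewrite sumrB sumr_const card_ord -[objr pb xs *+ _]mulr_natl mulrBr mulKf ?lerD2r //.
by rewrite pnatr_eq0 -lt0n.
Qed.

End Expectation.

(** * Integrals over the draws *)

Section Draws.
Context {R : realType} {disp : measure_display} {Omega : measurableType disp}.
Context (P : probability Omega R) {m n a b T : nat}.
Context (Aidx : Omega -> nat -> a.-tuple 'I_m) (Bidx : Omega -> nat -> b.-tuple 'I_n).
Context (indep : independent_uniform_draws P T Aidx Bidx).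

Definition observed (w : Omega) : T.-tuple (a.-tuple 'I_m * b.-tuple 'I_n) :=
  [tuple (Aidx w l, Bidx w l) | l < T].

Lemma observed_event (D0 : a.-tuple 'I_m * b.-tuple 'I_n) s :
  measurable [set w | observed w = s] /\
  P [set w | observed w = s] = ((m%:R ^+ a * n%:R ^+ b) ^- T)%:E.
Proof.
have := indep (fun l => (nth D0 s l).1) (fun l => (nth D0 s l).2).
rewrite /=; set E := (X in measurable X /\ _); suff <- : E = [set w | observed w = s].
  by [].
apply/seteqP; split=> w /= H.
  apply: eq_from_tnth => l; rewrite tnth_mktuple (tnth_nth D0).
  by have [-> ->] := H l (ltn_ord l); case: (nth _ _ _).
move=> l lT; rewrite -H -(tnth_nth D0 _ (Ordinal lT)) tnth_mktuple.
by [].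
Qed.

(** The integrand is a finite combination of indicators of events whose probabilities
    are prescribed. *)
Lemma integral_observed (D0 : a.-tuple 'I_m * b.-tuple 'I_n) h :
  (\int[P]_w (h (observed w))%:E = (avg h)%:E)%E.
Proof.
pose E s := [set w | observed w = s].
have mE s : measurable (E s) by have [] := observed_event D0 s.
have PE s : P (E s) = ((m%:R ^+ a * n%:R ^+ b) ^- T)%:E.
  by have [] := observed_event D0 s.
have hE w : (h (observed w))%:E = (\sum_s (h s)%:E * (\1_(E s) w)%:E)%E.
  rewrite (bigD1 (observed w)) //= big1 ?adde0 => [|s sw].
    by rewrite indicE mem_set // mule1.
  by rewrite indicE memNset ?mule0 // => ws; rewrite ws eqxx in sw.
under eq_integral do rewrite hE.
have iE s : P.-integrable setT (fun w => (\1_(E s) w)%:E : \bar R).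
  exact: integrable_indic.
rewrite integral_sum //; last by move=> s; exact: integrableZl.
rewrite (eq_bigr (fun s => ((m%:R ^+ a * n%:R ^+ b) ^- T * h s)%:E)); last first.
  move=> s _; rewrite integralZl //.
  rewrite integral_indic //.
  by rewrite setIT [X in (_ * X)%E](PE s) -EFinM mulrC.
rewrite sumEFin -mulr_sumr /avg card_tuple card_prod !card_tuple !card_ord.
by rewrite natrX natrM !natrX.
Qed.

End Draws.

(** * Choice of the parameters *)

Section Tuning.
Context {R : realType} (ell Dx DPhi eps : R).
Hypothesis ell0 : 0 <= ell.
Hypothesis Dx0 : 0 < Dx.
Hypothesis DPhi0 : 0 < DPhi.
Hypothesis eps0 : 0 < eps.

Let q := 6 * DPhi + 15 * ell * Dx ^+ 2.
Let v := eps / Dx ^+ 2.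
Let eta := Dx ^+ 2 / (10 * DPhi + 25 * ell * Dx ^+ 2).
Let w := (2 * eta)^-1.
Let D20 : 0 < Dx ^+ 2. Proof. by rewrite exprn_gt0. Qed.
Let v0 : 0 < v. Proof. by rewrite divr_gt0. Qed.
Let Dxn : Dx != 0. Proof. by rewrite gt_eqF. Qed.

Lemma scale_gt0 : 0 < q.
Proof. rewrite /q; have := mulr_ge0 ell0 (ltW D20); have := DPhi0; lra. Qed.

Let q0 := scale_gt0.
Let den0 : 0 < 10 * DPhi + 25 * ell * Dx ^+ 2.
Proof. have := mulr_ge0 ell0 (ltW D20); have := DPhi0; lra. Qed.

Lemma eta_gt0 : 0 < eta.
Proof. by rewrite divr_gt0. Qed.

Let wE : w = 5 * (DPhi / Dx ^+ 2) + 25 / 2 * ell.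
Proof. by rewrite /w /eta; field; rewrite Dxn gt_eqF. Qed.

Let wq : w * Dx ^+ 2 = 5 / 6 * q.
Proof. by rewrite wE /q; field. Qed.

Let g0 : 0 < DPhi / Dx ^+ 2. Proof. by rewrite divr_gt0. Qed.

Lemma weight_gt : ell / 2 < w.
Proof. rewrite wE; have := g0; have := ell0; lra. Qed.

Lemma batch_bound (c : R) (a : nat) : (0 < a)%N -> 0 < c ->
  c * ell ^+ 2 * Dx ^+ 4 / eps ^+ 2 <= a%:R -> ell ^+ 2 / a%:R <= v ^+ 2 / c.
Proof.
move=> a0 c0; rewrite ler_pdivrMr ?exprn_gt0 // => H.
rewrite ler_pdivrMr ?ltr0n // /v.
rewrite [leRHS](_ : _ = a%:R * eps ^+ 2 / (c * Dx ^+ 4)); last first.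
  by field; rewrite Dxn gt_eqF.
by rewrite ler_pdivlMr ?mulr_gt0 ?exprn_gt0 // mulrCA mulrA.
Qed.

Lemma bias_bound (a : nat) : (0 < a)%N ->
  1620 * ell ^+ 2 * Dx ^+ 4 / eps ^+ 2 <= a%:R -> ell / Num.sqrt a%:R <= v / 40.
Proof.
move=> a0 /(@batch_bound 1620 _ a0 ltac:(by rewrite ltr0n)) H.
have v40 : 0 <= v / 40 by rewrite divr_ge0 // ltW.
have e40 : 0 <= ell / Num.sqrt a%:R by rewrite divr_ge0 ?sqrtr_ge0.
rewrite -ler_sqr // sqrt_div_sqr; have := sqr_ge0 v; lra.
Qed.

(** The batch sizes give ell^2 (1/b + 18/a) <= v^2 / 81, and 5/1296 is what remains
    after dividing by 4 (w - ell/2) >= (16/5) q / Dx^2, using eps <= q. *)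
Lemma variance_bound (a b : nat) : (0 < a)%N -> (0 < b)%N -> eps <= q ->
  1620 * ell ^+ 2 * Dx ^+ 4 / eps ^+ 2 <= a%:R ->
  810 * ell ^+ 2 * Dx ^+ 4 / eps ^+ 2 <= b%:R ->
  ell ^+ 2 * (b%:R^-1 + 18 / a%:R) <= 5 / 1296 * v * (4 * (w - ell / 2)).
Proof.
move=> a0 b0 epsq /(@batch_bound 1620 _ a0 ltac:(by rewrite ltr0n)) Ha.
move=> /(@batch_bound 810 _ b0 ltac:(by rewrite ltr0n)) Hb.
have vq : v <= 6 * (DPhi / Dx ^+ 2) + 15 * ell.
  rewrite /v ler_pdivrMr // mulrDl -mulrA divfK ?gt_eqF //.
have H := ler_wpM2l (ltW v0) vq.
have := mulr_ge0 (ltW v0) (ltW g0); have := mulr_ge0 (ltW v0) ell0.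
rewrite wE; move: Ha Hb H; rewrite -expr2; nra.
Qed.

(** With v = eps / Dx^2, the left-hand side is about 0.0654 v and the right-hand side
    is v / 15, as w Dx^2 = 5 q / 6. *)
Lemma growth_rate : 2 * (v / 40) + 4 * (5 / 1296 * v) <= w * (2 / 25 * (eps / q)).
Proof.
have -> : w * (2 / 25 * (eps / q)) = 1 / 15 * v.
  have -> : w = 5 / 6 * q / Dx ^+ 2 by rewrite -wq mulfK ?gt_eqF.
  by rewrite /v; field; rewrite Dxn gt_eqF.
have := v0; lra.
Qed.

Context (S : nat).
Hypothesis SE : S%:Z = Num.floor (ln (q / eps) / ln 2) + 1.

Let pow2 : q / eps < 2 ^+ S /\ 2 ^+ S <= 2 * (q / eps).
Proof. by apply: floor_log2P => //; rewrite divr_gt0. Qed.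

Lemma total_iterations_bound : (total_iterations 10 S)%:R <= 20 * (q / eps).
Proof.
apply: (@le_trans _ _ (10 * 2 ^+ S)); last by case: pow2; lra.
by rewrite -natrX -natrM ler_nat leq_subr.
Qed.

(** The numerator is at most (1/6 + 5/12 + (5/6)(21/4)) q < 5 q, and the epoch length
    5 2^S exceeds 5 q / eps. *)
Lemma final_bound : (0 < S)%N ->
  (DPhi + 1 / 2 * w * Dx ^+ 2 +
   w * Dx ^+ 2 * (1 + 2 / 25 * (eps / q)) ^+ total_iterations 10 S) /
  (10 * 2 ^ S.-1)%:R <= eps.
Proof.
move=> S0; rewrite ler_pdivrMr ?ltr0n ?muln_gt0 ?expn_gt0 //.
have e0 : 0 < eps / q by rewrite divr_gt0.
have G : (1 + 2 / 25 * (eps / q)) ^+ total_iterations 10 S <= 21 / 4.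
  apply: growth_bound; first by rewrite mulr_ge0 ?ltW // divr_gt0.
  have := ler_wpM2l (ltW e0) total_iterations_bound.
  have -> : eps / q * (20 * (q / eps)) = 20 by field; rewrite !gt_eqF.
  lra.
have -> : (10 * 2 ^ S.-1)%:R = 5 * 2 ^+ S :> R.
  by rewrite natrM natrX -[in RHS](prednK S0) exprS; ring.
have Hq : q <= eps * 2 ^+ S by rewrite mulrC -ler_pdivrMr // ltW; case: pow2.
have wG := ler_wpM2l (ltW (mulr_gt0 (ltr0Sn R 4) q0)) G.
have DPq : DPhi <= q / 6.
  rewrite /q; have := mulr_ge0 ell0 (ltW D20); lra.
rewrite -mulrA wq; have := q0; move: wG Hq; set z := _ ^+ total_iterations _ _; lra.
Qed.

End Tuning.

(** * Number of samples *)

Section Samples.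
Context {R : realType}.

Lemma least_positive_le (y : R) (a : nat) :
  0 <= y -> least_positive_nat_ge y a -> a%:R <= y + 1.
Proof.
move=> y0 [a0 _ amin]; have [a1|a1] := leqP a 1.
  by apply: (@le_trans _ _ 1); [rewrite (ler_nat R a 1)|lra].
have [ya|ya] := leP y a.-1%:R; last first.
  have -> : (a%:R : R) = a.-1%:R + 1 by rewrite natr1 prednK.
  by rewrite lerD2r ltW.
have a1' : (0 < a.-1)%N by rewrite -ltnS prednK.
by have := amin _ a1' ya; rewrite leqNgt ltn_predL a0.
Qed.

Definition sample_constant (q e : R) : R := 4 / ln 2 + 20 * q * (10 * e + 6).

Lemma sample_constant_gt0 (q e : R) : 0 < q -> 0 <= e -> 0 < sample_constant q e.
Proof.
move=> q0 e0; have l2 : 0 < ln (2 : R) by rewrite ln_gt0 // ltr1n.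
by apply: addr_gt0; [rewrite divr_gt0 | apply: mulr_gt0; lra].
Qed.

(** As 2 q eps <= 1, the bound S <= log2 (2 q / eps) is at most 2 log2 (1 / eps); and
    with eps <= 1 the additive constants of the batch sizes are absorbed in 1 / eps^2. *)
Lemma sample_bound (q e eps : R) (S T m n a b : nat) :
  0 < q -> 0 <= e -> 0 < eps -> eps <= 1 -> 2 * q * eps <= 1 ->
  2 ^+ S <= 2 * (q / eps) -> T%:R <= 20 * (q / eps) ->
  a%:R <= 2 * e / eps ^+ 2 + 1 -> b%:R <= e / eps ^+ 2 + 1 ->
  (S * (2 * m + n) + T * (4 * a + 2 * b))%:R <=
  sample_constant q e * ((m + n)%:R * ln (1 / eps) + 1 / eps ^+ 3).
Proof.
move=> q0 e0 eps0 eps1 epsq HS HT Ha Hb.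
have l2 : 0 < ln (2 : R) by rewrite ln_gt0 // ltr1n.
set L := ln (1 / eps).
have L0 : 0 <= L by rewrite ln_ge0 // ler_pdivlMr // mul1r.
have SL : S%:R <= 2 / ln 2 * L.
  rewrite mulrAC ler_pdivlMr //.
  have -> : S%:R * ln (2 : R) = ln (2 ^+ S) by rewrite lnXn // mulr_natl.
  have -> : 2 * L = ln ((1 / eps) ^+ 2).
    by rewrite lnXn ?divr_gt0 // -[RHS]mulr_natl.
  rewrite ler_ln ?posrE ?exprn_gt0 ?divr_gt0 //; apply: (le_trans HS).
  rewrite [leLHS](_ : _ = 2 * q * eps * (1 / eps) ^+ 2); last first.
    by field; rewrite gt_eqF.
  by rewrite ler_piMl // sqr_ge0.
have N0 : 0 <= (m + n)%:R :> R by [].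
have part1 : (S * (2 * m + n))%:R <= 4 / ln 2 * ((m + n)%:R * L).
  rewrite natrM; apply: (@le_trans _ _ (2 / ln 2 * L * (2 * (m + n)%:R))).
    apply: ler_pM => //; rewrite -natrM ler_nat mulnDr leq_add2l.
    by rewrite leq_pmull.
  by rewrite le_eqVlt; apply/orP; left; apply/eqP; ring.
have ab : (4 * a + 2 * b)%:R <= (10 * e + 6) * (1 / eps ^+ 2).
  have i1 : 1 <= (eps ^+ 2)^-1 by rewrite invf_ge1 ?exprn_gt0 // exprn_ile1 // ltW.
  have -> : (4 * a + 2 * b)%:R = 4 * a%:R + 2 * b%:R :> R by rewrite natrD !natrM.
  rewrite mul1r; move: Ha Hb i1; move: (eps ^+ 2)^-1 => i; lra.
have part2 : (T * (4 * a + 2 * b))%:R <= 20 * q * (10 * e + 6) * (1 / eps ^+ 3).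
  rewrite natrM; apply: (le_trans (ler_pM _ _ HT ab)) => //.
  by rewrite le_eqVlt; apply/orP; left; apply/eqP; field; rewrite gt_eqF.
rewrite natrD; apply: (le_trans (lerD part1 part2)); rewrite /sample_constant.
have A0 : 0 <= 4 / ln (2 : R) by rewrite divr_ge0 // ltW.
have B0 : 0 <= 20 * q * (10 * e + 6) by apply: mulr_ge0; lra.
have X0 : 0 <= (m + n)%:R * L by rewrite mulr_ge0.
have Y0 : 0 <= 1 / eps ^+ 3 by rewrite divr_ge0 // exprn_ge0 // ltW.
move: (4 / ln 2) (20 * q * (10 * e + 6)) ((m + n)%:R * L) (1 / eps ^+ 3) A0 B0 X0 Y0.
by move=> A B X Y A0 B0 X0 Y0; have := mulr_ge0 A0 Y0; have := mulr_ge0 B0 X0; lra.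
Qed.

End Samples.

(** * The convergence theorem *)

Theorem theorem3 (R : realType) (ell Dx DPhi : R) (hDx : 0 < Dx)
    (hDPhi : 0 < DPhi) :
  exists C eps0 : R, [/\ 0 < C, 0 < eps0 &
  forall (d k m n : nat) (pb : problem R d k m n) (Lf lf Lg lg : R)
    (eps : R) (x0 xstar : 'cV[R]_d) (S a b : nat)
    (disp : measure_display) (Omega : measurableType disp)
    (P : probability Omega R)
    (Aidx : Omega -> nat -> a.-tuple 'I_m)
    (Bidx : Omega -> nat -> b.-tuple 'I_n),
  (0 < m)%N -> (0 < n)%N ->
  assumptions pb Lf lf Lg lg ->
  ell = Lf * lg + Lg ^+ 2 * lf ->
  is_argmin (feas pb) (objective pb) xstar ->
  0 < eps ->
  feas pb x0 ->
  l2norm (x0 - xstar) <= Dx ->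
  (objective pb x0 - objective pb xstar <= DPhi%:E)%E ->
  S%:Z = Num.floor (ln ((6 * DPhi + 15 * ell * Dx ^+ 2) / eps) / ln 2) + 1 ->
  (0 < a)%N -> (0 < b)%N ->
  1620 * ell ^+ 2 * Dx ^+ 4 / eps ^+ 2 <= a%:R ->
  810 * ell ^+ 2 * Dx ^+ 4 / eps ^+ 2 <= b%:R ->
  independent_uniform_draws P (total_iterations 10 S) Aidx Bidx ->
  let eta := Dx ^+ 2 / (10 * DPhi + 25 * ell * Dx ^+ 2) in
  let xhat w := scvrg_output pb x0 10 eta S (Aidx w) (Bidx w) in
  let samples w := scvrg_samples pb x0 10 eta S (Aidx w) (Bidx w) in
  [/\ forall w, feas pb (xhat w),
      (\int[P]_w objective pb (xhat w) <= objective pb xstar + eps%:E)%E &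
      least_positive_nat_ge (1620 * ell ^+ 2 * Dx ^+ 4 / eps ^+ 2) a ->
      least_positive_nat_ge (810 * ell ^+ 2 * Dx ^+ 4 / eps ^+ 2) b ->
      eps <= eps0 ->
      forall w, (samples w)%:R <=
        C * ((m + n)%:R * ln (1 / eps) + 1 / eps ^+ 3)]].
Proof.
(* The constants are chosen before the problem is known, so ell might be negative;
   then no problem satisfies the assumptions. *)
have [ell0|ell_lt0] := leP 0 ell; last first.
  exists 1, 1; split=> // d k m n pb Lf lf Lg lg eps x0 xstar S a b disp Omega P.
  move=> Aidx Bidx m0 n0 Hpb ellE; have := ell_ge0 Hpb.
  by rewrite -ellE leNgt ell_lt0.
set q := 6 * DPhi + 15 * ell * Dx ^+ 2.
have q0 : 0 < q by exact: scale_gt0.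
pose e := 810 * ell ^+ 2 * Dx ^+ 4.
have e0 : 0 <= e.
  have D4 : 0 <= Dx ^+ 4 by rewrite exprn_ge0 // ltW.
  exact: (mulr_ge0 (mulr_ge0 (ler0n _ _) (sqr_ge0 _)) D4).
exists (sample_constant q e), (Num.min 1 (1 / (2 * q))).
split.
- exact: sample_constant_gt0.
- by rewrite lt_min ltr01 divr_gt0 // mulr_gt0.
move=> d k m n pb Lf lf Lg lg eps x0 xs S a b disp Omega P Aidx Bidx m0 n0 Hpb ellE.
move=> [Xs xs_min] eps0 Xx0 hD hPhi SE a0 b0 Ha Hb indep eta xhat samples.
have [S_lt S_ge] : q / eps < 2 ^+ S /\ 2 ^+ S <= 2 * (q / eps).
  by apply: floor_log2P => //; rewrite divr_gt0.
have eta0 : 0 < eta by exact: eta_gt0.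
have T0 : (0 < S)%N -> (0 < total_iterations 10 S)%N.
  by move=> S0; rewrite (leq_trans _ (total_iterations_le 10 S0)).
have xhat_feas w : feas pb (xhat w).
  have [//|/T0 Tpos] := posnP S.
    by rewrite /xhat /scvrg_output => ->.
  have cX := convex_segment (feas_convex Hpb).
  have prox_in l r x (D : a.-tuple 'I_m * b.-tuple 'I_n) : (l <= total_iterations 10 S)%N ->
      feas pb (prox_update pb 10 eta S l r x D).
    by move=> lT; apply: (prox_feas Hpb); exact: stepsize_gt0.
  by case: (@epochs_in _ _ _ _ _ _ _ pb x0 10 eta S _ (Aidx w) (Bidx w) S
    isT cX Xx0 prox_in (leqnn S)).
split=> //.
- have xs_ninfty := reg_ninfty Hpb xs.
  (* If the minimum is infinite, there is nothing to prove. *)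
  have [rs|] := boolP (reg pb xs < +oo)%E; last first.
    rewrite -leNgt leye_eq => /eqP rs.
    by rewrite /objective rs addey // addye // leey.
  have k00 : (0 < 10)%N by [].
  have xs_dom : dom_obj pb xs by [].
  have objs := objectiveE Hpb rs.
  have r0 : (reg pb x0 < +oo)%E.
    move: hPhi; rewrite objs /objective.
    by have := reg_ninfty Hpb x0; case: (reg pb x0) => // r _ _; exact: ltry.
  have x0_dom : dom_obj pb x0 by [].
  have xs_objr_min x : dom_obj pb x -> objr pb xs <= objr pb x.
    move=> [Xx rx]; have := xs_min x Xx.
    by rewrite objs (objectiveE Hpb rx) lee_fin.
  have hPhi' : objr pb x0 - objr pb xs <= DPhi.
    by move: hPhi; rewrite objs (objectiveE Hpb r0) -EFinB lee_fin.
  have D0 : a.-tuple 'I_m * b.-tuple 'I_n.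
    by split; [exact: (nseq_tuple a (Ordinal m0)) | exact: (nseq_tuple b (Ordinal n0))].
  pose ref (s : (total_iterations 10 S).-tuple (a.-tuple 'I_m * b.-tuple 'I_n)) :=
    st_ref (run pb x0 eta D0 s S).
  pose obs w : (total_iterations 10 S).-tuple (a.-tuple 'I_m * b.-tuple 'I_n) :=
    observed Aidx Bidx w.
  have xhatE w : xhat w = ref (obs w).
    have E : epochs pb x0 10 eta S (Aidx w) (Bidx w) S = epochs pb x0 10 eta S
        (fun l => (nth D0 (obs w) l).1)
        (fun l => (nth D0 (obs w) l).2) S.
      apply: epochs_local => l lT.
      by rewrite -(tnth_nth D0 _ (Ordinal lT)) tnth_mktuple.
    by rewrite /xhat /scvrg_output /scvrg /bind E.
  have ref0 s : S = 0%N -> ref s = x0.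
    have epochs0 e' Ai Bi : e' = 0%N ->
        st_ref (epochs pb x0 10 eta S Ai Bi e').1 = x0 by move=> ->.
    exact: epochs0.
  have ref_dom s : dom_obj pb (ref s).
    have [S0|S0] := posnP S; first by rewrite ref0.
    by have [] := iter_dom Hpb k00 eta0 x0_dom xs_dom D0 s (T0 S0) (leqnn S).
  have objE w : objective pb (xhat w) = (objr pb (ref (obs w)))%:E.
    by rewrite xhatE (objectiveE Hpb) //; case: (ref_dom (obs w)).
  under eq_integral do rewrite objE.
  rewrite (integral_observed indep D0 (fun s => objr pb (ref s))) objs -EFinD lee_fin.
  rewrite -lerBlDl.
  have Tt : (0 < #|{: (total_iterations 10 S).-tuple (a.-tuple 'I_m * b.-tuple 'I_n)}|)%N.
    by apply/card_gt0P; exists (nseq_tuple _ D0).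
  rewrite -[X in _ - X](avg_cst _ Tt) -avgN -avgD.
  have [S0|S0] := posnP S.
    apply: avg_le_cst => // s; rewrite ref0 //.
    apply: (le_trans hPhi'); apply: ltW; move: S_lt; rewrite S0 expr0 ltr_pdivrMr // mul1r.
    apply: le_lt_trans; rewrite /q.
    have := mulr_ge0 ell0 (ltW (exprn_gt0 2 hDx)); lra.
  have epsq : eps <= q.
    have : 2 <= (2 : R) ^+ S by rewrite -[X in X <= _]expr1 ler_weXn2l // ler1n.
    move=> /le_trans/(_ S_ge); rewrite ler_pMr // ler_pdivlMr ?mul1r //.
  apply: le_trans (final_bound ell0 hDx hDPhi eps0 SE S0).
  have Dx2 : l2norm (x0 - xs) ^+ 2 <= Dx ^+ 2.
    by rewrite lerXn2r ?nnegrE ?l2norm_ge0 // ltW.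
  pose v := eps / Dx ^+ 2; have v0 : 0 <= v by rewrite divr_ge0 ?exprn_ge0 // ltW.
  have H1 : (Lf * lg + Lg ^+ 2 * lf) / Num.sqrt a%:R <= v / 40.
    by rewrite -ellE; exact: bias_bound.
  have H2 : (Lf * lg + Lg ^+ 2 * lf) / 2 < (2 * eta)^-1.
    by rewrite -ellE; exact: weight_gt.
  have H3 : 0 <= 5 / 1296 * v by exact: (mulr_ge0 (divr_ge0 (ler0n _ _) (ler0n _ _)) v0).
  have H4 : (Lf * lg + Lg ^+ 2 * lf) ^+ 2 * (b%:R^-1 + 18 / a%:R) <=
      5 / 1296 * v * (4 * ((2 * eta)^-1 - (Lf * lg + Lg ^+ 2 * lf) / 2)).
    by rewrite -ellE; exact: variance_bound.
  have H5 : 0 <= 2 / 25 * (eps / q).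
    by rewrite mulr_ge0 // divr_ge0 // ltW.
  have H6 := growth_rate ell0 hDx hDPhi eps0.
  exact: (expected_gap Hpb m0 n0 a0 b0 k00 eta0 x0_dom xs_dom xs_objr_min D0 S0
    H1 H2 H3 H4 H5 H6 Dx2 hPhi').
- move=> Hla Hlb; rewrite le_min => /andP[eps1 epsq] w.
  rewrite /samples /scvrg_samples /scvrg /bind epochs_cost addn0.
  apply: sample_bound => //.
  + by move: epsq; rewrite ler_pdivlMr ?mulr_gt0 // mulrC.
  + exact: (total_iterations_bound ell0 hDx hDPhi eps0 SE).
  + have e2 : 2 * e = 1620 * ell ^+ 2 * Dx ^+ 4 by rewrite /e !mulrA -natrM.
    rewrite e2; apply: least_positive_le Hla; rewrite -e2.
    by rewrite divr_ge0 ?exprn_ge0 ?(ltW eps0) // (mulr_ge0 (ler0n R 2) e0).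
  + apply: least_positive_le Hlb.
    by rewrite divr_ge0 ?exprn_ge0 // ltW.
Qed.
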